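(* For every $k\ge 3$, there exists $\varepsilon>0$ such that every graph $G$ with no pivot-minor isomorphic to $C_k$ satisfies \[\max(\alpha(G),\omega(G))\ge |V(G)|^\varepsilon.\]
   Context: All graphs are simple. $C_k$ is the cycle on $k$ vertices. $\alpha(G)$ is the maximum size of an independent set and $\omega(G)$ the maximum size of a clique of $G$. For an edge $uv$ of $G$, let $V_1=N(u)\cap N(v)$, $V_2=N(u)-N(v)$, $V_3=N(v)-N(u)$; the graph $G\wedge uv$ obtained by pivoting $uv$ is obtained by complementing adjacency between $V_i$ and $V_j$ for all $1\le i<j\le 3$ and swapping the labels of $u$ and $v$. A graph $H$ is a pivot-minor of $G$ if $H$ can be obtained from $G$ by deleting vertices and pivoting edges. *)

(* Defs.v *)
From mathcomp Require Import all_boot all_fingroup.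

Set Implicit Arguments.
Unset Strict Implicit.
Unset Printing Implicit Defensive.

Record sgraph := SGraph {
  vertex :> finType;
  adj : rel vertex;
  adj_sym : symmetric adj;
  adj_irr : irreflexive adj }.

Arguments adj {s}.

Definition isomorphic (G H : sgraph) : Prop :=
  exists2 f : G -> H, bijective f & forall x y : G, adj (f x) (f y) = adj x y.

Definition neighbours (G : sgraph) (u : G) : {set G} := [set x | adj u x].

Definition independent (G : sgraph) (A : {set G}) : bool :=
  [forall x in A, forall y in A, ~~ adj x y].

Definition clique (G : sgraph) (A : {set G}) : bool :=
  [forall x in A, forall y in A, (x != y) ==> adj x y].

Definition alpha (G : sgraph) : nat :=
  \max_(A : {set G} | independent A) #|A|.

Definition omega (G : sgraph) : nat :=
  \max_(A : {set G} | clique A) #|A|.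

(* The conjunct i != j only matters for k = 1, where it removes a loop;
   for k >= 3 this is the cycle on k vertices. *)
Definition cycle_adj (k : nat) : rel 'I_k :=
  fun i j => (i != j) && ((ordS i == j) || (ordS j == i)).

Lemma cycle_adj_sym (k : nat) : symmetric (@cycle_adj k).
Proof. by move=> i j; rewrite /cycle_adj eq_sym orbC. Qed.

Lemma cycle_adj_irr (k : nat) : irreflexive (@cycle_adj k).
Proof. by move=> i; rewrite /cycle_adj eqxx. Qed.

Definition cycle_graph (k : nat) : sgraph :=
  SGraph (@cycle_adj_sym k) (@cycle_adj_irr k).

Definition delete_adj (G : sgraph) (x : G) : rel {y : G | y != x} :=
  fun y z => adj (val y) (val z).

Lemma delete_adj_sym (G : sgraph) (x : G) : symmetric (@delete_adj G x).
Proof. by move=> y z; apply: adj_sym. Qed.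

Lemma delete_adj_irr (G : sgraph) (x : G) : irreflexive (@delete_adj G x).
Proof. by move=> y; apply: adj_irr. Qed.

Definition delete (G : sgraph) (x : G) : sgraph :=
  SGraph (@delete_adj_sym G x) (@delete_adj_irr G x).

Definition pivot1 (G : sgraph) (u v : G) : {set G} :=
  neighbours u :&: neighbours v.

(* When uv is an edge, v lies in N(u) - N(v) and u lies in N(v) - N(u).
   The ends of the pivoted edge do not take part in the complementation,
   so they are removed from these two sets. *)
Definition pivot2 (G : sgraph) (u v : G) : {set G} :=
  (neighbours u :\: neighbours v) :\ v.

Definition pivot3 (G : sgraph) (u v : G) : {set G} :=
  (neighbours v :\: neighbours u) :\ u.

Definition between (G : sgraph) (A B : {set G}) (x y : G) : bool :=
  (x \in A) && (y \in B) || (x \in B) && (y \in A).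

Definition pivot_flip (G : sgraph) (u v x y : G) : bool :=
  [|| between (pivot1 u v) (pivot2 u v) x y,
      between (pivot1 u v) (pivot3 u v) x y
    | between (pivot2 u v) (pivot3 u v) x y].

(* tperm u v swaps the labels of u and v. *)
Definition pivot_adj (G : sgraph) (u v : G) : rel G := fun x y =>
  let x' := tperm u v x in
  let y' := tperm u v y in
  adj x' y' (+) pivot_flip u v x' y'.

Lemma pivot_adj_sym (G : sgraph) (u v : G) : symmetric (pivot_adj u v).
Proof.
move=> x y; rewrite /pivot_adj adj_sym; congr (_ (+) _).
rewrite /pivot_flip /between.
by congr [|| _, _ | _]; rewrite orbC; congr (_ || _); rewrite andbC.
Qed.

Lemma pivot_adj_irr (G : sgraph) (u v : G) : irreflexive (pivot_adj u v).
Proof.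
move=> x; rewrite /pivot_adj adj_irr /pivot_flip /between !inE.
by case: (adj u _); case: (adj v _); rewrite ?andbF.
Qed.

Definition pivot (G : sgraph) (u v : G) : sgraph :=
  SGraph (pivot_adj_sym u v) (pivot_adj_irr u v).

(* pivot_minor H G: H is obtained from G. *)
Inductive pivot_minor (H : sgraph) : sgraph -> Prop :=
| pivot_minor_refl : pivot_minor H H
| pivot_minor_delete (G : sgraph) (x : G) :
    pivot_minor H (delete x) -> pivot_minor H G
| pivot_minor_pivot (G : sgraph) (u v : G) :
    adj u v -> pivot_minor H (pivot u v) -> pivot_minor H G.

(* Main.v *)
Require Import Defs.
From HB Require Import structures.
From mathcomp Require Import all_boot all_order all_algebra all_fingroup.
From mathcomp Require Import boolp zify.

Set Implicit Arguments.
Unset Strict Implicit.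
Unset Printing Implicit Defensive.

(* Let G have no pivot-minor C_k.

   Pivoting an edge of an induced path and deleting its ends shortens the path
   and acts linearly on the adjacency of any other vertex c to the path. Hence an
   induced path q_0, ..., q_h with a vertex c adjacent to both ends has C_k as a
   pivot-minor whenever h is large and h = k modulo 2, whatever the other
   neighbours of c are. Likewise the complement of a long induced path has C_k as
   a pivot-minor.

   By Rodl's theorem (in the form of Fox and Sudakov), applied to the induced
   subgraph C_k, some linear-size vertex set induces a graph which is very sparse
   or whose complement is. If it had no linear pure pair, the complement case
   would contain the complement of a long path. In the sparse case take a
   connected X whose neighbourhood A has a large second neighbourhood Y, grow an
   induced path E from A into Y whose last vertex alone sees a giant connected
   rest Y', and attach to each w in Y' a neighbour c in A with an induced path in
   X back to the start of E. Only the parity of this path matters, so it may be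
   assumed constant on a connected set K of more than max-degree many vertices of
   Y'. A shortest path from E towards K can be ended in K with either parity,
   because its last vertex does not see all of K; one of the two yields C_k.

   So there is a linear pure pair in every induced subgraph of G. The product of
   the independence and clique numbers is superadditive on pure pairs, and the
   polynomial bound follows by iteration. *)

(** * Pivoting and deleting *)

Definition has_cycle_minor (k : nat) (G : sgraph) : Prop :=
  exists2 H : sgraph, pivot_minor H G & isomorphic H (cycle_graph k).

(* The Schur complement over F_2: what remains of a graph after pivoting the
   edge uv and deleting u and v. *)
Definition pivot_delete (T : finType) (e : rel T) (u v : T) : rel T :=
  fun x y => e x y (+) (e x u && e v y) (+) (e x v && e u y).

(* Quantifying over all presentations G of the subgraph of e induced on A
   avoids transporting pivot-minors along isomorphisms. *)
Definition yields_cycle (k : nat) (T : finType) (e : rel T) (A : {set T}) : Prop :=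
  forall (G : sgraph) (f : G -> T), injective f -> codom f =i A ->
    (forall x y, adj x y = e (f x) (f y)) -> has_cycle_minor k G.

Lemma pivot_delete_sym (T : finType) (e : rel T) (u v : T) :
  symmetric e -> symmetric (pivot_delete e u v).
Proof.
move=> se x y; rewrite /pivot_delete (se y x) (se y u) (se y v) (se v x) (se u x).
by case: (e x y) (e x u) (e x v) (e u y) (e v y) => [] [] [] [] [].
Qed.

Lemma pivot_delete_irr (T : finType) (e : rel T) (u v : T) :
  symmetric e -> irreflexive e -> irreflexive (pivot_delete e u v).
Proof.
move=> se ie x; rewrite /pivot_delete ie (se v x) (se u x).
by case: (e x u) (e x v) => [] [].
Qed.

Section YieldsCycle.
Variables (k : nat) (T : finType).
Implicit Types (e : rel T) (A B : {set T}).

Lemma yields_cycleD1 e A a : yields_cycle k e (A :\ a) -> yields_cycle k e A.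
Proof.
have [aA|aA] := boolP (a \in A); last first.
  by rewrite (_ : A :\ a = A) //; apply/setDidPl; rewrite disjoint_sym disjoints1.
move=> yA G f fI fA fE.
have /codomP[x ax] : a \in codom f by rewrite fA.
have [||z|H HG HC] := yA (delete x) (f \o val).
- by move=> y z /= /fI /val_inj.
- move=> y; rewrite !inE -fA; apply/codomP/andP => [[z ->]|[ya /codomP[z yz]]].
    split; last exact: codom_f.
    by rewrite ax (inj_eq fI); exact: (valP z).
  have zx : z != x by rewrite -(inj_eq fI) -ax -yz.
  by exists (Sub z zx); rewrite /= yz.
- by move=> y; rewrite /= -fE.
- by exists H => //; apply: pivot_minor_delete HG.
Qed.

Lemma yields_cycleS e A B : A \subset B -> yields_cycle k e A -> yields_cycle k e B.
Proof.
move=> AB yA; have [n] := ubnP #|B :\: A|; elim: n B AB => // n IH B AB BAn.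
have [/eqP|[x]] := set_0Vmem (B :\: A).
  by rewrite setD_eq0 => BA; rewrite -(_ : A = B) //; apply/eqP; rewrite eqEsubset AB.
rewrite inE => /andP[xA xB]; apply: (@yields_cycleD1 _ _ x); apply: IH.
  by rewrite subsetD1 AB.
have : (B :\ x) :\: A \proper B :\: A.
  apply/properP; split; first by apply/setSD/subsetDl.
  by exists x; rewrite !inE ?xA ?eqxx ?andbF.
by move=> /proper_card; lia.
Qed.

(** The label swap in [pivot] moves only [u] and [v]. Both are deleted, so on the other vertices the
    pivot is the Schur complement. *)
Lemma yields_cycle_pivot e A u v : symmetric e -> irreflexive e ->
  u \in A -> v \in A -> e u v ->
  yields_cycle k (pivot_delete e u v) (A :\ u :\ v) -> yields_cycle k e A.
Proof.
move=> se ie uA vA uv yA G f fI fA fE.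
have /codomP[x ux] : u \in codom f by rewrite fA.
have /codomP[y vy] : v \in codom f by rewrite fA.
have xy : adj x y by rewrite fE -ux -vy.
have xny : y != x by apply: contraTneq xy => ->; rewrite adj_irr.
pose y' : delete (x : pivot x y) := Sub y xny.
have [||z|H HG HC] := yA (delete y') (f \o val \o val).
- by move=> a b /= /fI /val_inj /val_inj.
- move=> a; rewrite !inE -fA; apply/codomP/and3P => [[z ->]|[av au /codomP[z az]]].
    split; last exact: codom_f.
      by rewrite vy (inj_eq fI); have := valP z; rewrite -(inj_eq val_inj).
    by rewrite ux (inj_eq fI); exact: (valP (val z)).
  have zx : z != x by rewrite -(inj_eq fI) -ux -az.
  pose z' : delete (x : pivot x y) := Sub z zx.
  have zy : z' != y' by rewrite -(inj_eq val_inj) -(inj_eq fI) /= -vy -az.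
  by exists (Sub z' zy); rewrite /= az.
- move=> z'; case: z => z zy; case: z' => t ty.
  rewrite /= /delete_adj /= /delete_adj /= /pivot_adj.
  case: z zy => z zx /= zy; case: t ty => t tx /= ty.
  have {}zy : z != y by rewrite -(inj_eq val_inj) in zy.
  have {}ty : t != y by rewrite -(inj_eq val_inj) in ty.
  rewrite !tpermD 1?eq_sym // /pivot_flip /between !inE /pivot_delete ux vy -!fE.
  rewrite zx zy tx ty /= (@adj_sym G z x) (@adj_sym G z y).
  by move: (@adj G z t) (@adj G x z) (@adj G y z) (@adj G x t) (@adj G y t) => [] [] [] [] [].
- exists H => //; apply: pivot_minor_pivot xy _.
  by apply: pivot_minor_delete (pivot_minor_delete HG).
Qed.

Lemma yields_cycle_base e A (g : 'I_k -> T) : injective g ->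
  (forall i, g i \in A) -> (forall i j, e (g i) (g j) = cycle_adj i j) ->
  yields_cycle k e A.
Proof.
move=> gI gA gE; apply: (@yields_cycleS _ [set g i | i in 'I_k]).
  by apply/subsetP => _ /imsetP[i _ ->].
move=> G f fI fA fE; exists G; first exact: pivot_minor_refl.
have fg x : exists i, f x == g i.
  have : f x \in codom f by apply: codom_f.
  by rewrite fA => /imsetP[i _ ->]; exists i.
pose h x := xchoose (fg x).
have hE x : f x = g (h x) by apply/eqP/(xchooseP (fg x)).
have gf i : exists x, g i == f x.
  have : g i \in codom f by rewrite fA imset_f.
  by move=> /codomP[x ->]; exists x.
pose h' i := xchoose (gf i).
have h'E i : g i = f (h' i) by apply/eqP/(xchooseP (gf i)).
exists h => [|x y]; last by rewrite fE !hE gE.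
exists h' => x; first by apply: fI; rewrite -h'E -hE.
by apply: gI; rewrite -hE -h'E.
Qed.

Lemma yields_cycle_induced e A (v : nat -> T) : symmetric e -> irreflexive e ->
  (forall i, i < k -> v i \in A) ->
  (forall i j, i < j -> j < k -> v i != v j) ->
  (forall i j, i < j -> j < k -> e (v i) (v j) = (i.+1 %% k == j) || (j.+1 %% k == i)) ->
  yields_cycle k e A.
Proof.
move=> se ie vA vI vE; apply: (@yields_cycle_base _ _ (fun i : 'I_k => v i)).
- move=> i j vij; apply/val_inj/eqP; apply: contraT; rewrite neq_ltn => /orP[] ij.
    by have := vI _ _ ij (ltn_ord j); rewrite vij eqxx.
  by have := vI _ _ ij (ltn_ord i); rewrite vij eqxx.
- by move=> i; apply: vA.
- move=> i j; rewrite /cycle_adj -!(inj_eq val_inj) /=.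
  case: (ltngtP i j) => ij; last by rewrite (val_inj ij) ie.
    by rewrite vE.
  by rewrite se vE // orbC.
Qed.

End YieldsCycle.

Lemma has_cycle_minor_yields k (G : sgraph) (A : {set G}) :
  yields_cycle k adj A -> has_cycle_minor k G.
Proof.
move=> /(yields_cycleS (subsetT A)) /(_ G id); apply => //.
by move=> x; rewrite inE; apply/codomP; exists x.
Qed.

(** * Fans *)

(* An induced path q_0, ..., q_(N-1) and a vertex c, whose adjacency to the path
   is encoded by labels: c is adjacent to q_i iff S i and S (i + 2) differ. *)
Record fan (T : finType) (e : rel T) (A : {set T}) (c : T) (q : nat -> T)
    (S : nat -> bool) (N : nat) : Prop := Fan {
  fan_sym : symmetric e;
  fan_irr : irreflexive e;
  fan_center : c \in A;
  fan_mem : forall i, i < N -> q i \in A /\ q i != c;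
  fan_path : forall i j, i < j -> j < N ->
    q i != q j /\ e (q i) (q j) = (j == i.+1);
  fan_label : forall i, i < N -> e c (q i) = S i (+) S i.+2 }.

Section Fan.
Variables (T : finType).
Implicit Types (e : rel T) (A : {set T}) (c : T) (q : nat -> T) (S : nat -> bool).

Lemma fan_adj e A c q S N i j : fan e A c q S N -> i < N -> j < N ->
  e (q i) (q j) = (j == i.+1) || (i == j.+1).
Proof.
move=> F iN jN; case: (ltngtP i j) => [ij|ji|->].
- by rewrite (fan_path F ij jN).2; lia.
- by rewrite (fan_sym F) (fan_path F ji iN).2; lia.
- by rewrite (fan_irr F); lia.
Qed.

Lemma fan_shift e A c q S N : fan e A c q S N.+1 ->
  fan e A c (fun i => q i.+1) (fun i => S i.+1) N.
Proof.
case=> se ie cA mem path lab; split=> // [i iN|i j ij jN|i iN].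
- exact: mem.
- by have := path i.+1 j.+1 ij jN.
- exact: lab.
Qed.

Lemma fan_shrink e A c q S N : fan e A c q S N.+1 -> fan e A c q S N.
Proof.
case=> se ie cA mem path lab; split=> // [i iN|i j ij jN|i iN].
- by apply: mem; lia.
- by apply: path; lia.
- by apply: lab; lia.
Qed.

Definition skip2 (m : nat) (X : Type) (q : nat -> X) (i : nat) : X :=
  if i < m then q i else q i.+2.

(** The pivot changes the adjacency of [c] only at the two path vertices next to the contracted
    edge. There the sums telescope, as in [S i + S i.+2 + S i.+2 + S i.+4 = S i + S i.+4], so the
    labels at [m.+1] and [m.+2] disappear. *)
Lemma fan_contract e A c q S N m : fan e A c q S N.+2 -> m <= N ->
  fan (pivot_delete e (q m) (q m.+1)) (A :\ q m :\ q m.+1) c (skip2 m q)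
      (skip2 m.+1 S) N.
Proof.
move=> F mN; have adjE := fan_adj F; have [se ie cA mem path lab] := F.
have neq i j : i < N.+2 -> j < N.+2 -> i != j -> q i != q j.
  move=> iN jN; rewrite neq_ltn => /orP[ij|ji]; first by case: (path i j).
  by rewrite eq_sym; case: (path j i).
pose s i := if i < m then i else i.+2.
have qE i : skip2 m q i = q (s i) by rewrite /skip2 /s; case: ifP.
have sN i : i < N -> s i < N.+2 by rewrite /s; case: ifP; lia.
have sm i : s i != m by rewrite /s; case: ifP; lia.
have sm1 i : s i != m.+1 by rewrite /s; case: ifP; lia.
have mN2 : m < N.+2 by lia.
have m1N2 : m.+1 < N.+2 by lia.
split.
- exact: pivot_delete_sym.
- exact: pivot_delete_irr.
- by rewrite !inE cA !(eq_sym c) (mem _ mN2).2 (mem _ m1N2).2.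
- move=> i iN; have siN := sN i iN; rewrite qE !inE.
  by have [-> ->] := mem _ siN; rewrite !neq.
- move=> i j ij jN; have siN : s i < N.+2 by apply: sN; lia.
  have sjN := sN j jN; rewrite !qE neq //; last by rewrite /s; do 2 case: ifP; lia.
  split=> //; rewrite /pivot_delete !adjE //.
  have [jm|jm] := ltnP j m.
    have -> : s i = i by rewrite /s ifT //; lia.
    have -> : s j = j by rewrite /s jm.
    have -> : (m == i.+1) || (i == m.+1) = false by lia.
    have -> : (m.+1 == i.+1) || (i == m.+2) = false by lia.
    by rewrite !addbF; lia.
  have -> : s j = j.+2 by rewrite /s ltnNge jm.
  have [im|im] := ltnP i m.
    have -> : s i = i by rewrite /s im.
    have -> : (m.+1 == i.+1) || (i == m.+2) = false by lia.
    have -> : (j.+2 == i.+1) || (i == j.+3) = false by lia.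
    by rewrite addbF /=; lia.
  have -> : s i = i.+2 by rewrite /s ltnNge im.
  have -> : (m == i.+3) || (i.+2 == m.+1) = false by lia.
  have -> : (j.+2 == m.+1) || (m == j.+3) = false by lia.
  by rewrite andbF !addbF; lia.
- move=> i iN; have siN := sN i iN; rewrite qE /pivot_delete !lab // !adjE //.
  have [im|im] := ltnP i m.
    have -> : s i = i by rewrite /s im.
    have -> : skip2 m.+1 S i = S i by rewrite /skip2 ifT //; lia.
    have [im1|im1] := eqVneq i.+1 m.
      have -> : skip2 m.+1 S i.+2 = S i.+4 by rewrite /skip2 ifF //; lia.
      rewrite -im1 (_ : (i == i.+3) || (i.+2 == i.+1) = false) ?orbT; last by lia.
      by rewrite andbF andbT addbF; case: (S i) (S i.+2) (S i.+4) => [] [] [].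
    have -> : skip2 m.+1 S i.+2 = S i.+2 by rewrite /skip2 ifT //; lia.
    have -> : (i == m.+2) || (m.+1 == i.+1) = false by lia.
    rewrite orbF (_ : (i == m.+1) = false); last by lia.
    by rewrite !andbF !addbF.
  have -> : s i = i.+2 by rewrite /s ifF //; lia.
  have -> : skip2 m.+1 S i.+2 = S i.+4 by rewrite /skip2 ifF //; lia.
  have -> : (i.+2 == m.+1) || (m == i.+3) = false by lia.
  rewrite andbF addbF.
  have [->|im'] := eqVneq i m.
    by rewrite /skip2 ltnS leqnn eqxx /= andbT; case: (S m) (S m.+2) (S m.+4) => [] [] [].
  have -> : skip2 m.+1 S i = S i.+2 by rewrite /skip2 ifF //; lia.
  have -> : (i.+2 == m.+2) || (m.+1 == i.+3) = false by lia.
  by rewrite andbF addbF.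
Qed.

Lemma fan_cycle k e A c q S : 3 <= k -> fan e A c q S k.-1 ->
  (forall j, j < k.-1 -> S j (+) S j.+2 = (j == 0) || (j == k.-2)) ->
  yields_cycle k e A.
Proof.
move=> k3 F Sb; have adjE := fan_adj F; have [se ie cA mem path lab] := F.
pose g (i : 'I_k) := if i < k.-1 then q i else c.
have gc (i : 'I_k) : (i < k.-1) = false -> i = k.-1 :> nat by have := ltn_ord i; lia.
have cadj (i : nat) (j : 'I_k) : i < k.-1 -> j = k.-1 :> nat ->
    (i == 0) || (i == k.-2) = (i != j) && ((i.+1 %% k == j) || (j.+1 %% k == i)).
  move=> ik ->; have -> : k.-1.+1 = k by lia.
  by rewrite modnn modn_small; lia.
apply: (@yields_cycle_base _ _ _ _ g).
- move=> i j; rewrite /g; case: ifP => ik; case: ifP => jk.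
  + move=> qij; apply/val_inj => /=; apply/eqP.
    have : ~~ (q i != q j) by rewrite qij eqxx.
    by apply: contraR; rewrite neq_ltn => /orP[ij|ji]; [|rewrite eq_sym]; case: (path _ _ ij jk) || case: (path _ _ ji ik).
  + by move=> qc; have := (mem _ ik).2; rewrite qc eqxx.
  + by move=> qc; have := (mem _ jk).2; rewrite -qc eqxx.
  + by move=> _; apply/val_inj; rewrite /= (gc _ ik) (gc _ jk).
- by move=> i; rewrite /g; case: ifP => // /mem[].
- move=> i j; rewrite /cycle_adj -!(inj_eq val_inj) /= /g.
  case: ifP => ik; case: ifP => jk.
  + rewrite adjE // !modn_small; lia.
  + by rewrite se lab // Sb // (cadj _ _ ik (gc _ jk)).
  + by rewrite lab // Sb // (cadj _ _ jk (gc _ ik)) eq_sym orbC.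
  + by rewrite ie (gc _ ik) (gc _ jk) eqxx.
Qed.

(* Contracting a path edge deletes two consecutive labels, so any subsequence
   of labels with positions of alternating parity can be realised. *)
Lemma fan_subsequence k e A c q S N (t : nat -> nat) : 3 <= k -> fan e A c q S N ->
  (forall j, j < k -> t j < t j.+1 /\ odd (t j.+1 - t j)) -> t k <= N.+1 ->
  (forall j, j < k.-1 -> S (t j) (+) S (t j.+2) = (j == 0) || (j == k.-2)) ->
  yields_cycle k e A.
Proof.
move=> k3; have [n] := ubnP N.
elim: n => // n IH in e A q S N t * => Nn F tinc tN Sb.
have tmono i j : i <= j -> j <= k -> t i + (j - i) <= t j.
  elim: j => [|j IHj]; first by rewrite leqn0 => /eqP ->; lia.
  rewrite leq_eqVlt => /orP[/eqP -> _|ij jk]; first by lia.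
  by have := IHj ij (ltnW jk); have [] := tinc j jk; lia.
(* First the path is trimmed at both ends until [t 0 = 0] and [t k = N.+1]; dropping an end vertex
   drops one end label. *)
have tk := tmono 0 k; have [t0|t0] := posnP (t 0); last first.
  case: N => [|N] in Nn F tN *; first by lia.
  have tpos j : j <= k -> 0 < t j by move=> jk; have := tmono 0 j; lia.
  apply: (IH _ _ _ _ N (fun j => (t j).-1) _ (fan_shift F)) => //.
  - move=> j jk; have [tj to] := tinc j jk; have a := tpos j (ltnW jk).
    have -> : (t j.+1).-1 - (t j).-1 = t j.+1 - t j by lia.
    by split=> //; lia.
  - by lia.
  - by move=> j jk; rewrite -Sb // !prednK // tpos //; lia.
case: (ltnP (t k) N.+1) => tN'.
  case: N => [|N] in Nn F tN tN' *; first by lia.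
  by apply: (IH _ _ _ _ N t _ (fan_shrink F)) => //; lia.
have [kN|kN] := leqP k N; last first.
  have tj j : j <= k -> t j = j by move=> jk; have := tmono 0 j; have := tmono j k; lia.
  have NE : N = k.-1 by lia.
  rewrite NE in F; apply: fan_cycle k3 F _ => j jk.
  by rewrite -Sb // !tj //; lia.
(* Now [t k] exceeds [k], so some gap is not 1; being odd it is at least 3, and the two labels right
   after [t j] can be contracted away. *)
have [j jk tj] : exists2 j, j < k & (t j).+2 < t j.+1.
  suff : [exists j : 'I_k, (t j).+2 < t j.+1] by case/existsP => j; exists j.
  apply: contraTT isT => /existsPn tle.
  have tj j : j <= k -> t j = j.
    elim: j => // j IHj jk; have := tle (Ordinal jk); have [] := tinc j jk.
    by rewrite /= (IHj (ltnW jk)); lia.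
  by have := tj k (leqnn k); lia.
case: N => [|[|N]] in Nn F tN tN' kN *; [by lia | by lia |].
have mN : t j <= N by have := tmono j.+1 k; lia.
pose t' i := if i <= j then t i else t i - 2.
have skE i : i <= k -> skip2 (t j).+1 S (t' i) = S (t i).
  move=> ik; rewrite /skip2 /t'; have [ij|ij] := leqP i j.
    by rewrite ifT //; have := tmono i j; lia.
  have := tmono j.+1 i ij ik; move=> h; rewrite ifF; last by lia.
  by congr S; lia.
have [qj qj1] : t j < N.+2 /\ (t j).+1 < N.+2 by lia.
apply: (yields_cycle_pivot (fan_sym F) (fan_irr F) (fan_mem F qj).1 (fan_mem F qj1).1).
  by rewrite (fan_adj F) // eqxx.
apply: (IH _ _ _ _ N t' _ (fan_contract F mN)) => //.
- by lia.
- move=> i ik; have [ti to] := tinc i ik; rewrite /t'.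
  have := tmono j.+1 i.+1; case: (ltngtP i j) => [//|ji|ij _].
    move=> /(_ ltac:(lia) ik) ti1; have := tmono j.+1 i ji (ltnW ik) => ti2.
    have -> : t i.+1 - 2 - (t i - 2) = t i.+1 - t i by lia.
    by split=> //; lia.
  rewrite ij in ti to *; have -> : t j.+1 - 2 - t j = t j.+1 - t j - 2 by lia.
  by split; lia.
- by rewrite /t' ifF; lia.
- by move=> i ik; rewrite !skE ?Sb //; lia.
Qed.

End Fan.

(** * Choosing a subsequence of labels *)

Fixpoint labels (b : nat -> bool) (n : nat) : bool :=
  if n is m.+2 then labels b m (+) b m else false.

Lemma frequent_pair (f g : nat -> bool) (r : seq nat) (m : nat) : 4 * m <= size r ->
  exists x y, m <= count (fun i => (f i == x) && (g i == y)) r.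
Proof.
have sum4 : size r = count (fun i => (f i == true) && (g i == true)) r
    + count (fun i => (f i == true) && (g i == false)) r
    + count (fun i => (f i == false) && (g i == true)) r
    + count (fun i => (f i == false) && (g i == false)) r.
  by elim: r => //= i r ->; case: (f i) (g i) => [] []; lia.
rewrite sum4 => mr.
have [h|?] := leqP m (count (fun i => (f i == true) && (g i == true)) r).
  by exists true, true.
have [h|?] := leqP m (count (fun i => (f i == true) && (g i == false)) r).
  by exists true, false.
have [h|?] := leqP m (count (fun i => (f i == false) && (g i == true)) r).
  by exists false, true.
by exists false, false; lia.
Qed.

Lemma frequent_pair_sequence (S : nat -> bool) (k : nat) : exists v y (n : nat -> nat),
  (forall j, j < k ->
     [/\ 2 <= n j < 4 * k + 2, S (n j).*2 = v & S (n j).*2.+1 = y]) /\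
  (forall j, j.+1 < k -> n j < n j.+1).
Proof.
(* Starting at index 2 puts all chosen positions at 4 or beyond, past both candidate starts 0 and 2
   of the subsequence. *)
have [v [y]] := @frequent_pair (fun i => S i.*2) (fun i => S i.*2.+1) (iota 2 (4 * k)) k
  ltac:(by rewrite size_iota).
rewrite -size_filter; set p := (X in filter X _); set I := filter p _ => kI.
have Isorted : sorted ltn I by rewrite sorted_filter ?iota_ltn_sorted //; exact: ltn_trans.
exists v, y, (nth 0 I); split=> j jk.
  have : nth 0 I j \in I by apply: mem_nth; apply: leq_trans kI.
  rewrite mem_filter mem_iota /p => /andP[/andP[/eqP-> /eqP->]] /andP[-> h'].
  by split=> //=; rewrite addnC.
by apply: (sorted_ltn_nth ltn_trans) => //; rewrite inE; apply: leq_trans kI => //; exact: ltnW.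
Qed.

(* Some pair [(v, y)] of labels at positions [(2 i, 2 i + 1)] occurs [k] times.
   The subsequence starts with a label [~~ v], runs through labels
   [y, v, y, v, ...] and stops at the end of the path, where a label changes. *)
Lemma label_subsequence (S : nat -> bool) (k h : nat) :
  3 <= k -> S 0 = false -> S 2 = true -> S h.+2 = ~~ S h -> odd h = odd k ->
  8 * k + 10 <= h ->
  exists t : nat -> nat, [/\ forall j, j < k -> t j < t j.+1 /\ odd (t j.+1 - t j),
    t k <= h.+2 &
    forall j, j < k.-1 -> S (t j) (+) S (t j.+2) = (j == 0) || (j == k.-2)].
Proof.
move=> k3 S0 S2 Sh hk hlarge; have [v [y [n [nB ninc]]]] := frequent_pair_sequence S k.
(* The label at [t k.-2] is [y] or [v] according to the parity of [k], and the final label has to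
   differ from it. As [S h] and [S h.+2] differ, one of them equals [w]. *)
pose w := ~~ (if odd k then y else v).
have [tend [tendB tendodd Send]] : exists tend, [/\ h <= tend <= h.+2, odd tend = odd k & S tend = w].
  have [Shw|/eqP Shw] := eqVneq (S h) w; first by exists h; rewrite leqnn leqW // leqW.
  exists h.+2; rewrite leqnn leqW //= negbK; split=> //; rewrite Sh.
  by move: Shw; case: (S h) (w) => [] [].
(* Since [S 0] is false and [S 2] is true, one of the even positions 0 and 2 carries the label
   [~~ v]. *)
pose t j := if j == 0 then (if v then 0 else 2) else
  if j == k then tend else (n j.-1).*2 + odd j.
have t0 : t 0 = if v then 0 else 2 by [].
have tk : t k = tend by rewrite /t eqxx gtn_eqF //; apply: leq_trans k3.
have tmid j : 0 < j -> j < k -> t j = (n j.-1).*2 + odd j.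
  by move=> j0 jk; rewrite /t gtn_eqF // ltn_eqF.
clearbody t; exists t.
have Smid j : 0 < j -> j < k -> S (t j) = if odd j then y else v.
  move=> j0 jk; rewrite tmid //; have [_ Sv Sy] := nB j.-1 (leq_ltn_trans (leq_pred _) jk).
  by case: (odd j); rewrite ?addn1 ?addn0.
have St0 : S (t 0) = ~~ v by rewrite t0; case: (v).
have todd j : j <= k -> odd (t j) = odd j.
  case: (posnP j) => [-> _|j0]; first by rewrite t0; case: (v).
  rewrite leq_eqVlt => /orP[/eqP->|jk]; last by rewrite tmid // oddD odd_double oddb.
  by rewrite tk.
have tmidB j : 0 < j -> j < k -> 4 <= t j - odd j <= 8 * k + 2.
  move=> j0 jk; rewrite tmid //; have [nB1 _ _] := nB j.-1 (leq_ltn_trans (leq_pred _) jk).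
  by clear - nB1; lia.
have tinc j : j < k -> t j < t j.+1.
  move=> jk; have [j0|j0] := posnP j.
    have := tmidB 1 isT (ltnW k3); rewrite j0 t0.
    by case: (v) => h1; clear - h1; lia.
  have := tmidB j j0 jk; move: jk; rewrite leq_eqVlt => /orP[/eqP jk|jk].
    rewrite jk tk; clear - tendB hlarge; case: (odd j); lia.
  move=> _; rewrite !tmid //; last exact: ltnW.
  have := ninc j.-1; rewrite prednK // => /(_ (ltnW jk)).
  by clear; rewrite /=; case: (odd j); lia.
split.
- move=> j jk; split; first exact: tinc.
  by rewrite oddB ?(ltnW (tinc j jk)) // (todd _ jk) (todd _ (ltnW jk)) /=; case: odd.
- by rewrite tk; case/andP: tendB.
- move=> j jk; have [->|j0] := posnP j.
    by rewrite St0 Smid //; case: (v).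
  have jk' : j < k by apply: leq_trans jk (leq_pred _).
  rewrite Smid //=; have [jk2|jk2] := eqVneq j k.-2.
    have -> : j.+2 = k by clear - jk2 k3; lia.
    rewrite tk Send /w (_ : odd j = odd k); last by clear - jk2 k3; lia.
    by case: ifP => _; case: (y) (v) => [] [].
  rewrite Smid //; last by clear - jk jk2; lia.
  by rewrite /= negbK addbb.
Qed.

Lemma long_fan_cycle (k : nat) (T : finType) (e : rel T) (A : {set T}) (c : T)
    (q : nat -> T) (h : nat) :
  3 <= k -> symmetric e -> irreflexive e -> c \in A ->
  (forall i, i <= h -> q i \in A /\ q i != c) ->
  (forall i j, i < j -> j <= h -> q i != q j /\ e (q i) (q j) = (j == i.+1)) ->
  e c (q 0) -> e c (q h) -> odd h = odd k -> 8 * k + 10 <= h ->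
  yields_cycle k e A.
Proof.
move=> k3 se ie cA mem path c0 ch hk hlarge.
(* [labels] solves [S i (+) S i.+2 = e c (q i)] with [S 0] and [S 1] false. *)
pose S := labels (fun i => e c (q i)).
have F : fan e A c q S h.+1.
  by split=> // i _; rewrite /S /= addbA addbb.
have S2 : S 2 = true by rewrite /S /= c0.
have Sh : S h.+2 = ~~ S h by rewrite /S /= ch addbT.
have [t [tinc tk St]] := label_subsequence k3 (erefl : S 0 = false) S2 Sh hk hlarge.
exact: fan_subsequence k3 F tinc tk St.
Qed.

(** * Complements of paths *)

(* Adjacency is that of a path plus the rank-one matrix b b^T over F_2; for b = 1
   this is the complement of a path. *)
Record antipath (T : finType) (e : rel T) (A : {set T}) (q : nat -> T)
    (b : nat -> bool) (N : nat) : Prop := Antipath {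
  antipath_sym : symmetric e;
  antipath_irr : irreflexive e;
  antipath_mem : forall i, i < N -> q i \in A;
  antipath_adj : forall i j, i < j -> j < N ->
    q i != q j /\ e (q i) (q j) = (j == i.+1) (+) (b i && b j) }.

Section Antipath.
Variables (k : nat) (T : finType).
Implicit Types (e : rel T) (A : {set T}) (q : nat -> T).

(** Among the first [k] indices the ones are 0 and [k.-1], so the rank-one term adds exactly the
    edge that closes the path. *)
Lemma antipath_cycle e A q r N : 2 < k -> r = k.-2 -> k <= N ->
  antipath e A q (fun i => (i == 0) || (r < i)) N -> yields_cycle k e A.
Proof.
move=> k3 -> kN [se ie mem path].
apply: (@yields_cycle_induced _ _ _ _ q) => // [i ik|i j ij jk|i j ij jk].
- exact: mem (leq_trans ik kN).
- by have [] := path i j ij (leq_trans jk kN).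
- rewrite (path i j ij (leq_trans jk kN)).2 (@modn_small i.+1); last by lia.
  have [jk1|jk1] := eqVneq j.+1 k; first by rewrite jk1 modnn; lia.
  by rewrite modn_small; lia.
Qed.

(* Pivoting on two ones far apart, the second being the last entry, deletes
   both and flips their neighbours. *)
Lemma antipath_step e A q r N : r + 6 <= N ->
  antipath e A q (fun i => (i == 0) || (r < i)) N ->
  [/\ e (q r.+2) (q N.-1), q r.+2 \in A, q N.-1 \in A &
  antipath (pivot_delete e (q r.+2) (q N.-1)) (A :\ q r.+2 :\ q N.-1)
    (fun i => if i < r.+2 then q i else q i.+1)
    (fun i => (i == 0) || (r.+2 < i)) (N - 3)].
Proof.
move=> rN [se ie mem path].
have rN' : r.+2 < N.-1 by lia.
have [adj1 memr memN] : [/\ e (q r.+2) (q N.-1), q r.+2 \in A & q N.-1 \in A].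
  by split; [rewrite (path _ _ rN' _).2; lia | apply: mem; lia | apply: mem; lia].
split=> //.
pose s i := if i < r.+2 then i else i.+1.
have qE i : (if i < r.+2 then q i else q i.+1) = q (s i) by rewrite /s; case: ifP.
have adjr i : i < N -> i != r.+2 -> e (q i) (q r.+2) = (i == 0) || (r.+3 < i).
  move=> iN; rewrite neq_ltn => /orP[] ir.
    by rewrite (path i r.+2 ir _).2; lia.
  by rewrite se (path r.+2 i ir _).2; lia.
have adjN i : i.+2 < N -> e (q i) (q N.-1) = (i == 0) || (r < i).
  by move=> iN; rewrite (path i N.-1 _ _).2; lia.
have neq i j : i < N -> j < N -> i != j -> q i != q j.
  move=> iN jN; rewrite neq_ltn => /orP[] ij; first by case: (path i j).
  by rewrite eq_sym; case: (path j i).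
(* Besides the two pivoted vertices, the last-but-one vertex is dropped: its entry would be flipped
   to zero. *)
have sN i : i < N - 3 -> (s i).+2 < N by rewrite /s; case: ifP; lia.
have sr i : s i != r.+2 by rewrite /s; case: ifP; lia.
split.
- exact: pivot_delete_sym.
- exact: pivot_delete_irr.
- move=> i iN; have := sN i iN; rewrite qE !inE => siN.
  by rewrite mem ?neq ?sr //; lia.
- move=> i j ij jN; have siN := sN i (ltn_trans ij jN); have sjN := sN j jN.
  have sij : s i < s j by rewrite /s; do 2 case: ifP; lia.
  rewrite !qE neq ?(ltn_eqF sij) //; [|lia|lia].
  split=> //; rewrite /pivot_delete (se (q N.-1)) (se (q r.+2)).
  rewrite !adjN ?adjr ?sr //; [|lia|lia].
  rewrite (path _ _ sij _).2; last by lia.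
  have onesE l : (s l == 0) || (r.+3 < s l) = (l == 0) || (r.+2 < l).
    by rewrite /s; clear; case: ltnP => ?; lia.
  have zerosE l : (s l == 0) || (r < s l) =
      ((l == 0) || (r.+2 < l)) (+) ((l == r.+1) || (l == r.+2)).
    by rewrite /s; clear; case: ltnP => ?; lia.
  (* Deleting [q r.+2] breaks the path; the product of the flips at its two neighbours supplies the
     edge that rejoins them. *)
  have pathE : (s j == (s i).+1) = (j == i.+1) (+) ((i == r.+1) && (j == r.+2)).
    by rewrite /s; clear - ij; do 2 case: ltnP => ?; lia.
  have newE : ((i == r.+1) || (i == r.+2)) && ((j == r.+1) || (j == r.+2)) =
      (i == r.+1) && (j == r.+2) by clear - ij; lia.
  rewrite !onesE !zerosE pathE -newE; clear.
  move: ((i == 0) || _) ((j == 0) || _) ((i == r.+1) || _) ((j == r.+1) || _) (j == _).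
  by do 5 case.
Qed.

(** Creates the single zero that odd [k] requires. On the path [q 1] is next to both pivoted
    vertices and is flipped twice, so only [q 3] becomes a zero, and it is joined to [q 1]. *)
Lemma antipath_start e A q N : 4 <= N -> antipath e A q xpredT N ->
  [/\ e (q 0) (q 2), q 0 \in A, q 2 \in A &
  antipath (pivot_delete e (q 0) (q 2)) (A :\ q 0 :\ q 2)
    (fun i => if i == 0 then q 1 else q i.+2)
    (fun i => (i == 0) || (1 < i)) (N - 2)].
Proof.
move=> N4 [se ie mem path].
have [adj1 mem0 mem2] : [/\ e (q 0) (q 2), q 0 \in A & q 2 \in A].
  by split; [rewrite (path _ _ _ _).2; lia | apply: mem; lia | apply: mem; lia].
split=> //.
pose s i := if i == 0 then 1 else i.+2.
have qE i : (if i == 0 then q 1 else q i.+2) = q (s i) by rewrite /s; case: ifP.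
have adj0 i : 0 < i -> i < N -> e (q i) (q 0) = (i != 1).
  by move=> i0 iN; rewrite se (path 0 i _ _).2; lia.
have adj2 i : i != 2 -> i < N -> e (q i) (q 2) = (i != 1) && (i != 3).
  rewrite neq_ltn => /orP[] i2 iN; first by rewrite (path i 2 _ _).2; lia.
  by rewrite se (path 2 i _ _).2; lia.
have neq i j : i < N -> j < N -> i != j -> q i != q j.
  move=> iN jN; rewrite neq_ltn => /orP[] ij; first by case: (path i j).
  by rewrite eq_sym; case: (path j i).
have sN i : i < N - 2 -> s i < N by rewrite /s; case: ifP; lia.
have s0 i : 0 < s i by rewrite /s; case: ifP; lia.
have s2 i : s i != 2 by rewrite /s; case: ifP; lia.
split.
- exact: pivot_delete_sym.
- exact: pivot_delete_irr.
- move=> i iN; have := sN i iN; rewrite qE !inE => siN.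
  by rewrite mem ?neq ?s2 ?gtn_eqF //; lia.
- move=> i j ij jN; have siN := sN i (ltn_trans ij jN); have sjN := sN j jN.
  have sij : s i < s j by rewrite /s; do 2 case: ifP; lia.
  rewrite !qE neq ?(ltn_eqF sij) //.
  split=> //; rewrite /pivot_delete (se (q 0)) (se (q 2)).
  rewrite !adj0 ?adj2 //.
  rewrite (path _ _ sij _).2 //.
  rewrite /s; clear - ij; case: i j ij => [|i] [|[|j]] //= ij; rewrite !eqSS.
  by case: i ij => [|i] ij; rewrite /=; case: (j == _).
Qed.

(** Each [antipath_step] adds two zeros and costs three vertices, so [N + 2 * r] does not decrease
    while [r] climbs to [k.-2] within its parity class. *)
Lemma antipath_zeros e A q r N : 2 < k -> r <= k.-2 -> odd r = odd k ->
  4 * k <= N + 2 * r -> antipath e A q (fun i => (i == 0) || (r < i)) N ->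
  yields_cycle k e A.
Proof.
move=> k3; have [n] := ubnP (k - r).
elim: n => // n IH in e A q r N * => kn rk rodd kN AP.
have [rk2|rk2] := eqVneq r k.-2; first by apply: antipath_cycle AP => //; lia.
have rk4 : r.+2 <= k.-2 by lia.
have [|uv uA vA AP'] := antipath_step _ AP; first by lia.
apply: (yields_cycle_pivot (antipath_sym AP) (antipath_irr AP) uA vA uv).
by apply: IH AP'; lia.
Qed.

Lemma long_antipath_cycle e A q N : 2 < k -> 4 * k + 2 <= N ->
  antipath e A q xpredT N -> yields_cycle k e A.
Proof.
move=> k3 kN AP; have [kodd|keven] := boolP (odd k).
  have [|uv uA vA AP'] := antipath_start _ AP; first by lia.
  apply: (yields_cycle_pivot (antipath_sym AP) (antipath_irr AP) uA vA uv).
  by apply: antipath_zeros AP'; lia.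
apply: (@antipath_zeros e A q 0 N) => //; try lia.
by case: AP => se ie mem path; split=> // i j ij jN; rewrite (path _ _ ij jN).2; case: (path _ _ ij jN) => -> _; split=> //; lia.
Qed.

End Antipath.

(** * Connected sets and induced paths *)

Definition compl_rel (T : finType) (e : rel T) : rel T :=
  fun x y => (x != y) && ~~ e x y.

Lemma compl_rel_sym (T : finType) (e : rel T) : symmetric e -> symmetric (compl_rel e).
Proof. by move=> es x y; rewrite /compl_rel eq_sym es. Qed.

Lemma compl_rel_irr (T : finType) (e : rel T) : irreflexive (compl_rel e).
Proof. by move=> x; rewrite /compl_rel eqxx. Qed.

Section Connected.
Variables (T : finType) (e : rel T).
Implicit Types (A B K S V W X Y : {set T}) (s t : seq T).

Definition anticomplete A B : bool := [forall x in A, forall y in B, ~~ e x y].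

(** Phrased through cuts, so that a property is spread over [S] by applying this to the set of
    vertices that have it. *)
Definition connected_in S : Prop :=
  forall X, X \subset S -> X != set0 -> X != S ->
    exists x y, [/\ x \in X, y \in S :\: X & e x y].

Definition no_large_anticomplete V d : Prop :=
  forall A B, A \subset V -> B \subset V -> [disjoint A & B] -> anticomplete A B ->
    #|A| < d \/ #|B| < d.

Definition max_degree V d : Prop :=
  forall v, v \in V -> #|[set y in V | e v y]| <= d.

Fixpoint induced_path s : bool :=
  if s is x :: s' then
    [&& x \notin s', (if s' is y :: t then e x y && all (fun z => ~~ e x z) t else true)
      & induced_path s']
  else true.

Lemma anticompleteP A B :
  reflect (forall x y, x \in A -> y \in B -> ~~ e x y) (anticomplete A B).
Proof.
apply: (iffP forall_inP) => [AB x y /AB /forall_inP xB /xB //|AB x xA].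
by apply/forall_inP => y; apply: AB.
Qed.

Lemma no_large_anticompleteS V W d :
  W \subset V -> no_large_anticomplete V d -> no_large_anticomplete W d.
Proof. by move=> WV nV A B AW BW; apply: nV; apply: subset_trans WV. Qed.

Lemma connected_set1 x : connected_in [set x].
Proof. by move=> X; rewrite subset1 => /orP[/eqP->|/eqP->]; rewrite eqxx. Qed.

Hypothesis e_sym : symmetric e.

Lemma connected_setU1 S a x : connected_in S -> x \in S -> e x a ->
  connected_in (a |: S).
Proof.
move=> cS xS xa X XaS X0 XneaS; have [aS|aS] := boolP (a \in S).
  by move: XaS XneaS; rewrite (setUidPr _) ?sub1set // => XS XneS; apply: cS.
have [XS0|XS0] := eqVneq (X :&: S) set0.
  have [y yX] := set0Pn _ X0.
  have ya : y = a.
    have := subsetP XaS y yX; rewrite !inE => /orP[/eqP //|yS].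
    by have := in_set0 y; rewrite -XS0 inE yX yS.
  exists y, x; split=> //; last by rewrite ya e_sym.
  rewrite !inE xS orbT andbT; apply/negP => xX.
  by have := in_set0 x; rewrite -XS0 inE xX xS.
have [XSS|XSS] := eqVneq (X :&: S) S.
  have aX : a \notin X.
    apply: contra XneaS => aX; rewrite eqEsubset XaS /= subUset sub1set aX /=.
    by rewrite -XSS subsetIl.
  exists x, a; split=> //; last by rewrite !inE eqxx aX.
  by have := xS; rewrite -XSS inE => /andP[].
have [y [z [yXS zS yz]]] := cS (X :&: S) (subsetIr _ _) XS0 XSS.
move: yXS zS; rewrite !inE => /andP[yX yS] /andP[zXS zS].
by exists y, z; split=> //; rewrite !inE zS orbT andbT; move: zXS; rewrite zS andbT.
Qed.

(** Take [K] minimal among the sets of more than [#|S| - d] vertices with no edge to the rest of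
    [S]. If a cut split [K], neither side could be that large, so each would leave at least [d]
    vertices outside and have fewer than [d] itself; but [K] has more than [2 * d]. *)
Lemma giant_component S d : 0 < d -> no_large_anticomplete S d -> 3 * d <= #|S| ->
  exists K, [/\ K \subset S, #|S| < #|K| + d, connected_in K & anticomplete K (S :\: K)].
Proof.
move=> d0 nS Sd.
pose P (K : {set T}) := [&& K \subset S, #|S| < #|K| + d & anticomplete K (S :\: K)].
have PS : P S.
  rewrite /P subxx /=; apply/andP; split; first by lia.
  by apply/anticompleteP => x y; rewrite setDv inE.
case: (arg_minnP (fun K : {set T} => #|K|) PS) => K /and3P[KS Kd KA] Kmin.
exists K; split=> // X XK X0 XneK; apply: contrapT => ncut.
have XS := subset_trans XK KS; have KXS : K :\: X \subset S := subset_trans (subsetDl _ _) KS.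
have XKX : anticomplete X (K :\: X).
  by apply/anticompleteP => x y xX yKX; apply/negP => xy; apply: ncut; exists x, y.
have XA : anticomplete X (S :\: X).
  apply/anticompleteP => x y xX; rewrite inE => /andP[yX yS].
  have [yK|yK] := boolP (y \in K).
    by apply: (anticompleteP _ _ XKX); rewrite // inE yX yK.
  by apply: (anticompleteP _ _ KA); [exact: (subsetP XK)|rewrite inE yK yS].
have KXA : anticomplete (K :\: X) (S :\: (K :\: X)).
  apply/anticompleteP => x y xKX; rewrite !inE negb_and negbK => /andP[yXK yS].
  have [yX|yX] := boolP (y \in X).
    by rewrite e_sym; apply: (anticompleteP _ _ XKX).
  rewrite (negPf yX) /= in yXK.
  apply: (anticompleteP _ _ KA); last by rewrite inE yXK yS.
  by move: xKX; rewrite inE => /andP[].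
have small Y : Y \proper K -> anticomplete Y (S :\: Y) -> #|Y| < d.
  move=> YK YA; have YS := subset_trans (proper_sub YK) KS.
  have [|//|SY] := nS Y (S :\: Y) YS (subsetDl _ _) _ YA.
    by rewrite disjoints_subset; apply/subsetP => y yY; rewrite !inE yY.
  have : P Y by rewrite /P YS YA andbT /=; have := cardsID Y S; rewrite (setIidPr YS); clear - SY; lia.
  by move=> /Kmin; rewrite leqNgt (proper_card YK).
have := small X; rewrite properEneq XneK XK => /(_ isT XA) Xd.
have KXp : K :\: X \proper K.
  rewrite properEneq subsetDl andbT; apply: contraNneq X0 => KX.
  by rewrite -subset0; apply/subsetP => x xX; have := subsetP XK x xX; rewrite -KX !inE xX.
have := small _ KXp KXA; have := cardsID X K; rewrite (setIidPr XK).
by clear - Sd Kd Xd; lia.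
Qed.

Lemma induced_path_catr s t : induced_path (s ++ t) -> induced_path t.
Proof. by elim: s => //= x s IH /and3P[_ _ /IH]. Qed.

Lemma induced_path_cat s t x0 : induced_path s -> induced_path t ->
  (forall a b, a \in s -> b \in t ->
     a != b /\ e a b = (a == last x0 s) && (b == head x0 t)) ->
  induced_path (s ++ t).
Proof.
elim: s => //= a s IH /and3P[aNs aadj sP] tP st.
have aNt : a \notin t.
  by apply/negP => /(st a a (mem_head _ _))[]; rewrite eqxx.
rewrite mem_cat negb_or aNs aNt /=; case: s => [|c s] in IH aNs aadj sP st *.
  rewrite /= in st *; rewrite tP andbT.
  case: t => [|b t] in tP aNt st {IH} * => //.
  have [_ ->] := st a b (mem_head _ _) (mem_head _ _); rewrite !eqxx /=.
  apply/allP => z zt; have [_ ->] := st a z (mem_head _ _) (mem_behead (s := b :: t) zt).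
  rewrite eqxx /=; apply: contraTneq zt => ->.
  by move: tP => /= /andP[].
rewrite /= in aadj *; move/andP: aadj => [-> /allP aadj] /=; apply/andP; split.
  apply/allP => z; rewrite mem_cat => /orP[/aadj //|zt].
  have [_ ->] := st a z (mem_head _ _) zt; rewrite negb_and; apply/orP; left.
  by apply: contraNneq aNs => /= ->; rewrite mem_last.
apply: (IH sP tP) => x y xs yt; have [xy ->] := st x y (mem_behead (s := a :: _) xs) yt.
by split.
Qed.

Lemma induced_path_nth s x0 i j : induced_path s -> i < j -> j < size s ->
  nth x0 s i != nth x0 s j /\ e (nth x0 s i) (nth x0 s j) = (j == i.+1).
Proof.
elim: s i j => // a s IH [|i] [|j] // /and3P[aNs aadj sP] ij js; last exact: IH.
have as_ : nth x0 s j \in s by apply: mem_nth.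
split; first by apply: contraNneq aNs => /= ->.
case: s => [|b s] in aadj js as_ {IH aNs sP} * => //.
case/andP: aadj => ab /allP aadj; case: j => [|j] in js as_ ij *; first by rewrite /= ab.
by apply/negbTE/aadj/mem_nth.
Qed.

(* Prepending a neighbour of some vertex of an induced path and jumping to its
   last neighbour leaves an induced path. *)
Lemma induced_path_shortcut t x : induced_path t -> has (e x) t ->
  exists t', [/\ induced_path (x :: t'), {subset x :: t' <= x :: t},
    last x t' = last x t & t' = [::] -> x = last x t].
Proof.
elim: t => // a t IH tP.
have tP' : induced_path t by case/and3P: tP.
have [xt _|] := boolP (has (e x) t).
  have [t' [t'P sub t'l t'0]] := IH tP' xt.
  have tl : last x t = last a t by case: (t) xt.
  exists t'; split=> //; rewrite /= -?tl //.
  by move=> y /sub; rewrite !inE => /orP[->//|->]; rewrite !orbT.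
have [xa|xa] := eqVneq x a.
  rewrite -{}xa in tP * => xNt _; exists t; split=> //=.
    by move=> y; rewrite !inE => ->; rewrite orbT.
  by move=> ->.
have [xt|xt] := boolP (x \in t).
  move=> _ _; case/splitPr: xt tP' {IH tP} => t1 t2 /induced_path_catr t2P.
  exists t2; split=> //; last first.
  - by move=> ->; rewrite /= last_cat.
  - by rewrite /= last_cat.
  - by move=> y; rewrite !inE mem_cat inE => /orP[->//|->]; rewrite !orbT.
rewrite -all_predC => xNt; rewrite /= => /orP[xadj|]; last first.
  by move=> /hasP[y /(allP xNt)/= /negbTE ->].
exists (a :: t); split=> //.
by rewrite /= in tP *; rewrite inE negb_or xa xt xadj tP xNt.
Qed.

(** The vertices with such a path include those of [S] in [R]. If some were missing, an edge would
    leave this set, and the shortcut of the path extended by its outer end would be a path for that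
    end. *)
Lemma induced_path_to S x (R : pred T) : connected_in S -> x \in S ->
  (exists2 y, y \in S & R y) ->
  exists s, [/\ induced_path (x :: s), {subset x :: s <= S}, R (last x s) &
    forall y, y \in x :: s -> R y -> y = last x s].
Proof.
move=> cS xS [y yS Ry].
pose Q z := exists s, [/\ induced_path (z :: s), {subset z :: s <= S}, R (last z s) &
    forall y, y \in z :: s -> R y -> y = last z s].
have Qnil z : z \in S -> R z -> Q z.
  by move=> zS Rz; exists [::]; split=> // w; rewrite inE => /eqP->.
pose X := [set z in S | `[< Q z >]].
suff : X = S by move/setP => /(_ x); rewrite xS inE xS => /asboolP.
apply/eqP; apply/negPn/negP => XneS.
have [||a [b [aX bX ab]]] := cS X _ _ XneS.
- by apply/subsetP => z; rewrite inE => /andP[].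
- by apply/set0Pn; exists y; rewrite inE yS; apply/asboolP/Qnil.
move: aX bX; rewrite !inE => /andP[aS /asboolP[s [sP sS Rs Rlast]]] /andP[].
rewrite negb_and => bX bS; rewrite bS /= in bX; case/negP: bX; apply/asboolP.
have [Rb|nRb] := boolP (R b); first exact: Qnil.
have [|t [tP tsub tl t0]] := induced_path_shortcut (x := b) sP.
  by rewrite /= e_sym ab.
have tl' : last b t = last a s by rewrite tl.
exists t; split=> //.
- by move=> z /tsub; rewrite inE => /orP[/eqP->|/sS].
- by rewrite tl'.
- move=> z /tsub; rewrite inE => /orP[/eqP->|zs Rz]; first by rewrite (negbTE nRb).
  by rewrite tl'; apply: Rlast.
Qed.

(** The Gyarfas path argument. Let [u] be the end of the path and [K] a giant component of the
    non-neighbours of [u] in [Y']. An edge leaving [K] inside [Y'] must reach a neighbour of [u],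
    which becomes the new end, with [K] as the new rest. A step loses at most [d] neighbours and [d]
    vertices outside [K]. *)
Lemma gyarfas_path V d Y a M : 0 < d -> Y \subset V -> a \in V -> a \notin Y ->
  connected_in Y -> (exists2 y, y \in Y & e a y) ->
  no_large_anticomplete V d -> max_degree V d -> 2 * d * M + 4 * d <= #|Y| ->
  exists E Y', [/\ induced_path (a :: E), size E = M, {subset E <= Y} & Y' \subset Y] /\
    [/\ connected_in Y', #|Y| <= #|Y'| + 2 * d * M, {subset a :: E <= [predC Y']},
      exists2 y, y \in Y' & e (last a E) y &
      forall x y, x \in a :: E -> y \in Y' -> e x y -> x = last a E].
Proof.
move=> d0 YV aV aY cY aadj nV dV.
elim: M => [|M IH] Ysize.
  exists [::], Y; split; split=> //; first by lia.
    by move=> x; rewrite !inE => /eqP->.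
  by move=> x y; rewrite inE => /eqP.
have [|E [Y' [[EP Esize EY Y'Y] [cY' Y'size aEY' [z zY' uz] Elast]]]] := IH.
  by clear - Ysize; nia.
set u := last a E in uz Elast.
have uV : u \in V.
  have := mem_last a E; rewrite -/u inE => /orP[/eqP->//|/EY /(subsetP YV)] //.
have Y'V := subset_trans Y'Y YV.
pose Z := [set y in Y' | ~~ e u y].
have ZY' : Z \subset Y' by apply/subsetP => y; rewrite inE => /andP[].
have Zsize : #|Y'| <= #|Z| + d.
  have := cardsID [set y | e u y] Y'.
  have -> : Y' :\: [set y | e u y] = Z by apply/setP => y; rewrite !inE andbC.
  have : #|Y' :&: [set y | e u y]| <= #|[set y in V | e u y]|.
    apply/subset_leq_card/subsetP => y; rewrite !inE => /andP[/(subsetP Y'V) -> ->] //.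
  by have := dV u uV; clear; lia.
have [|K [KZ Ksize cK KA]] := giant_component d0 (no_large_anticompleteS (subset_trans ZY' Y'V) nV).
  by clear - Zsize Ysize Y'size; nia.
have KY' := subset_trans KZ ZY'.
have zK : z \notin K.
  by apply/negP => /(subsetP KZ); rewrite inE uz andbF.
have [||x [y [xK yK xy]]] := cY' K KY'.
- rewrite -card_gt0; clear - Zsize Ysize Y'size Ksize; nia.
- by apply: contraNneq zK => ->.
move: yK; rewrite inE => /andP[yK yY'].
have uy : e u y.
  apply: contraTT xy => uy; apply: (anticompleteP _ _ KA) => //.
  by rewrite !inE yK yY' uy.
have yaE : y \notin a :: E by apply/negP => /aEY'; rewrite inE yY'.
exists (rcons E y), K; split; split.
- rewrite -rcons_cons -cats1; apply: (@induced_path_cat _ _ a) => // b c bE.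
  rewrite inE => /eqP ->; split; first by apply: contraNneq yaE => <-.
  rewrite /= eqxx andbT -/u; have [->//|bu] := eqVneq b u.
  by apply: contraNF bu => bY; rewrite (Elast b y).
- by rewrite size_rcons Esize.
- by move=> b; rewrite mem_rcons inE => /orP[/eqP->|/EY //]; apply: (subsetP Y'Y).
- exact: subset_trans KY' Y'Y.
- exact: cK.
- by clear - Zsize Ysize Y'size Ksize; nia.
- move=> b; rewrite -rcons_cons mem_rcons inE => /orP[/eqP->|/aEY']; rewrite !inE //.
  by apply: contra => /(subsetP KY').
- by rewrite last_rcons; exists x => //; rewrite e_sym.
- move=> b w; rewrite last_rcons -rcons_cons mem_rcons inE => /orP[/eqP->//|bE] wK bw.
  have bu := Elast b w bE (subsetP KY' w wK) bw.
  by have := subsetP KZ w wK; rewrite inE -bu bw andbF.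
Qed.

End Connected.

(** * Sparse and co-sparse graphs *)

Section SecondNeighbourhood.
Variables (T : finType) (e : rel T).
Implicit Types (A B K S V W X Y : {set T}) (s t : seq T).
Hypotheses (e_sym : symmetric e) (e_irr : irreflexive e).

(** Here vertices are counted instead of edges, which reverses the parity and raises the length
    bound of [long_fan_cycle] by one. *)
Lemma long_fan_path_cycle k A c s : 3 <= k -> induced_path e s ->
  {subset c :: s <= A} -> c \notin s -> e c (head c s) -> e c (last c s) ->
  odd (size s) != odd k -> 8 * k + 11 <= size s -> yields_cycle k e A.
Proof.
move=> k3 sP sA cs ch cl sodd ssize.
have s0 : 0 < size s by clear - ssize; lia.
have mem i : i <= (size s).-1 -> nth c s i \in s.
  by move=> ih; apply: mem_nth; rewrite -(prednK s0).
apply: (@long_fan_cycle k T e A c (nth c s) (size s).-1) => //.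
- by apply: sA; rewrite mem_head.
- move=> i /mem ins; split; first by apply: sA; rewrite inE ins orbT.
  by apply: contraNneq cs => <-.
- by move=> i j ij js; apply: induced_path_nth => //; rewrite -(prednK s0).
- by rewrite nth_last.
- by move: sodd; rewrite -{1}(prednK s0) /=; case: (odd _) (odd k) => [] [].
- by clear - ssize; lia.
Qed.

(* A connected set maximal among those whose closed neighbourhood covers at
   most half of a giant component has a large second neighbourhood. *)
Lemma second_neighbourhood V d : 0 < d -> no_large_anticomplete e V d ->
  max_degree e V d -> 40 * d <= #|V| ->
  exists X a Y,
    [/\ X \subset V, a \in V, Y \subset V & anticomplete e X Y] /\
    [/\ connected_in e X, connected_in e Y, #|V| <= 2 * #|Y| + 5 * d,
        [disjoint X & Y] & a \notin X :|: Y] /\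
    [/\ exists2 x, x \in X & e x a, exists2 y, y \in Y & e a y &
      forall y, y \in Y -> exists c,
        [/\ c \in V, c \notin X :|: Y, e c y & exists2 x, x \in X & e x c]].
Proof.
move=> d0 nV dV Vsize.
have [|H [HV Hsize cH _]] := giant_component e_sym d0 nV; first by clear - Vsize; lia.
pose N S := [set y in H | (y \in S) || [exists x in S, e x y]].
pose P S := [&& S \subset H, `[< connected_in e S >] & 2 * #|N S| <= #|H|].
have inN S y : y \in N S = (y \in H) && ((y \in S) || [exists x in S, e x y]) by rewrite inE.
have [x xH] : exists x, x \in H.
  by apply/set0Pn; rewrite -card_gt0; clear - Vsize Hsize d0; lia.
have Hdeg y : y \in H -> #|[set z in V | e y z]| <= d by move/(subsetP HV); apply: dV.
have Px : P [set x].
  rewrite /P sub1set xH /=; apply/andP; split; first by apply/asboolP/connected_set1.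
  have : N [set x] \subset x |: [set y in V | e x y].
    apply/subsetP => y; rewrite inN !inE => /andP[yH /orP[->//|/existsP[z]]].
    by rewrite inE => /andP[/eqP-> ->]; rewrite (subsetP HV) // orbT.
  move/subset_leq_card; have := Hdeg x xH; rewrite cardsU1.
  by move: (_ \notin _) => b; clear - Vsize Hsize d0; lia.
case: (arg_maxnP (fun S : {set T} => #|S|) Px) => X /and3P[XH /asboolP cX XN] Xmax.
have XNX : X \subset N X.
  by apply/subsetP => y yX; rewrite inN yX (subsetP XH).
have NXH : N X \subset H by apply/subsetP => y; rewrite inN => /andP[].
have X0 : X != set0.
  by rewrite -card_gt0; apply: leq_trans (Xmax _ Px); rewrite cards1.
have [|x1 [b [x1X bX x1b]]] := cH X XH X0.
  apply: contraTneq XN => XHE; rewrite -ltnNge.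
  have := subset_leq_card XNX; rewrite XHE; clear - Hsize Vsize d0; lia.
move: bX; rewrite inE => /andP[bX bH].
have bN : b \in N X.
  by rewrite inN bH /=; apply/orP; right; apply/existsP; exists x1; rewrite x1X.
(* By maximality [b |: X] covers more than half of [H], and [b] contributes at most [d] new
   vertices. *)
have NXlarge : #|H| < 2 * (#|N X| + d).
  have Nb : N (b |: X) \subset N X :|: [set y in V | e b y].
    apply/subsetP => y; rewrite inN => /andP[yH yN]; rewrite in_setU inN yH /=; move: yN.
    rewrite !inE => /orP[/orP[/eqP->|->//]|/existsP[z]].
      by move: bN; rewrite inN bH /= => ->.
    rewrite !inE => /andP[/orP[/eqP->|zX] zy]; first by rewrite zy (subsetP HV) // orbT.
    by apply/orP; left; apply/orP; right; apply/existsP; exists z; rewrite zX.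
  have NPb : ~~ P (b |: X).
    by apply/negP => /Xmax; rewrite cardsU1 bX; clear; lia.
  have bcard : #|H| < 2 * #|N (b |: X)|.
    rewrite ltnNge; apply: contra NPb => bcard; rewrite /P bcard andbT.
    rewrite subUset sub1set bH XH /=; apply/asboolP.
    by apply: (connected_setU1 e_sym cX x1X x1b).
  have := subset_leq_card Nb; have := (leq_card_setU (N X) [set y in V | e b y]).1.
  by have := Hdeg b bH; clear - bcard; lia.
pose A := N X :\: X.
pose Y1 := [set y in H :\: N X | [exists c in A, e c y]].
have Y1P y : y \in Y1 -> [/\ y \in H, y \notin N X & exists2 c, c \in A & e c y].
  rewrite !inE -/(N X) => /andP[/andP[yN yH] /existsP[c /andP[cA cy]]].
  by split=> //; exists c.
have AP c : c \in A -> [/\ c \in H, c \notin X, c \in N X & exists2 x, x \in X & e x c].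
  rewrite inE => /andP[cNX cN]; split=> //; first exact: (subsetP NXH).
  move: cN; rewrite inN (negbTE cNX) /= => /andP[_ /existsP[z /andP[zX zc]]].
  by exists z.
have Y1H : Y1 \subset H by apply/subsetP => y /Y1P[].
have XY1 : anticomplete e X Y1.
  apply/anticompleteP => z y zX /Y1P[yH yN _]; apply: contra yN => zy.
  by rewrite inN yH /=; apply/orP; right; apply/existsP; exists z; rewrite zX.
have Y1N : Y1 \subset H :\: N X.
  by apply/subsetP => y /Y1P[yH yN _]; rewrite inE yN yH.
(* Vertices beyond [N X] without a neighbour in [A] have none in [N X] at all, and [N X] has at
   least [d] vertices. *)
have restsmall : #|(H :\: N X) :\: Y1| < d.
  have [|||//|//] := nV (N X) ((H :\: N X) :\: Y1) (subset_trans NXH HV).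
  - by apply: subset_trans HV; apply: subset_trans (subsetDl _ _) (subsetDl _ _).
  - rewrite disjoints_subset; apply/subsetP => y yN.
    by rewrite in_setC in_setD in_setD yN /= andbF.
  - apply/anticompleteP => z y zN; rewrite in_setD in_setD => /and3P[yY1 yN yH].
    apply/negP => zy; have [zX|zX] := boolP (z \in X).
      case/negP: yN; rewrite inN yH /=; apply/orP; right.
      by apply/existsP; exists z; rewrite zX.
    case/negP: yY1; rewrite inE in_setD yN yH /=; apply/existsP; exists z.
    by rewrite inE zX zN.
  by move=> NXd; move: NXlarge Hsize Vsize; clear - NXd; lia.
have Y1size : #|H| < 2 * #|Y1| + 2 * d + 1.
  have := cardsID (N X) H; rewrite (setIidPr NXH).
  have := cardsID Y1 (H :\: N X); rewrite (setIidPr Y1N).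
  by move: NXlarge restsmall XN; clear; lia.
have nY1 : no_large_anticomplete e Y1 d.
  by apply: no_large_anticompleteS nV; apply: subset_trans HV.
have [|Y [YY1 Ysize cY _]] := giant_component e_sym d0 nY1.
  by clear - Y1size Hsize Vsize; lia.
have [y yY] : exists y, y \in Y.
  by apply/set0Pn; rewrite -card_gt0; clear - Vsize Hsize Y1size Ysize d0; lia.
have notXY c : c \in A -> c \notin X :|: Y.
  move=> /AP[_ cNX cN _]; rewrite inE negb_or cNX; apply/negP => /(subsetP YY1)/Y1P[_].
  by rewrite cN.
have [_ _ [a aA ay]] := Y1P y (subsetP YY1 y yY).
have [aH aX aN [x2 x2X x2a]] := AP a aA.
exists X, a, Y; split; [split|split; [split|split]].
- exact: subset_trans HV.
- exact: (subsetP HV).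
- by apply: subset_trans HV; apply: subset_trans Y1H.
- apply/anticompleteP => z w zX /(subsetP YY1); exact: (anticompleteP _ _ _ XY1).
- exact: cX.
- exact: cY.
- by clear - Hsize Y1size Ysize; lia.
- rewrite disjoints_subset; apply/subsetP => z zX; rewrite inE.
  by apply/negP => /(subsetP YY1)/Y1P[_]; rewrite (subsetP XNX).
- exact: notXY.
- by exists x2.
- by exists y.
- move=> w /(subsetP YY1)/Y1P[_ _ [c cA cw]]; have [cH' _ _ xc] := AP c cA.
  by exists c; split=> //; [exact: (subsetP HV)|exact: notXY].
Qed.

End SecondNeighbourhood.

(** * Cycles in sparse graphs *)

Section SparseCase.
Variables (T : finType) (e : rel T).
Implicit Types (A B K S V W X Y : {set T}) (s t : seq T).
Hypotheses (e_sym : symmetric e) (e_irr : irreflexive e).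

Lemma induced_path_rcons s x y : induced_path e (x :: s) -> y \notin x :: s ->
  (forall z, z \in x :: s -> e z y = (z == last x s)) ->
  induced_path e (x :: rcons s y).
Proof.
move=> sP ys adj; rewrite -rcons_cons -cats1; apply: (@induced_path_cat _ _ _ _ x) => // a b as_.
rewrite inE => /eqP->; split; first by apply: contraNneq ys => <-.
by rewrite adj //= eqxx andbT.
Qed.

(* A short path to the neighbourhood of K, whose last vertex cannot see all of
   K, yields induced paths of both parities to vertices of K. *)
Lemma paths_of_both_parities V d u Y K (b : bool) : max_degree e V d ->
  u \in V -> u \notin Y -> Y \subset V -> connected_in e Y ->
  (exists2 y, y \in Y & e u y) ->
  K \subset Y -> connected_in e K -> d < #|K| -> 0 < d ->
  exists g w, [/\ induced_path e (u :: rcons g w), {subset rcons g w <= Y}, w \in K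
    & odd (size g) = b].
Proof.
move=> dV uV uY YV cY [y0 y0Y uy0] KY cK Kd d0.
pose R := [pred y | [exists w in K, e y w]].
have RP y w : w \in K -> e y w -> R y by move=> wK yw; apply/existsP; exists w; rewrite wK.
have [y1 y1K] : exists y, y \in K by apply/set0Pn; rewrite -card_gt0; apply: leq_trans Kd.
have cuY : connected_in e (u |: Y).
  by apply: (connected_setU1 e_sym cY y0Y); rewrite e_sym.
(* An edge inside [K] shows that some vertex of [Y] sees [K], so there is a target for the path. *)
have [|||x1 [w1 [x1y w1K x1w1]]] := cK [set y1].
- by rewrite sub1set.
- by apply/set0Pn; exists y1; rewrite inE.
- apply: contraTneq Kd => <-; rewrite cards1; clear - d0; lia.
have [|g [gP gsub Rg gR]] := induced_path_to e_sym (R := R) cuY (setU11 u Y).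
  exists x1; last by apply: RP x1w1; move: w1K; rewrite inE => /andP[].
  rewrite inE; apply/orP; right; apply: (subsetP KY).
  by move: x1y; rewrite inE => /eqP->.
have gY : {subset g <= Y}.
  move=> y yg; have := gsub y; rewrite !inE yg orbT => /(_ isT) /orP[/eqP yu|//].
  by move: gP => /=; rewrite -yu yg.
(* A path vertex in [K] would put its predecessor in [R], although only the last vertex of the path
   lies there. *)
have gK y : y \in u :: g -> y \notin K.
  move=> yg; apply/negP => yK.
  have yu : y != u by apply: contraNneq uY => <-; apply: (subsetP KY).
  have : y \in g by move: yg; rewrite inE (negbTE yu).
  move=> /(nthP u)[i ig iy].
  have [] := induced_path_nth u gP (ltnSn i) (ig : i.+1 < size (u :: g)).
  rewrite eqxx => _ adj; have Ri : R (nth u (u :: g) i).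
    by apply: RP yK _; rewrite -iy.
  have inei : nth u (u :: g) i \in u :: g by apply: mem_nth; rewrite /= ltnS ltnW.
  have := gR _ inei Ri; rewrite (last_nth u).
  have [|+ _] := induced_path_nth u gP (ig : i < size g) _; first by [].
  by rewrite -[X in _ != X]/(nth u (u :: g) (size g)) => /eqP.
set l := last u g in Rg gR.
have lV : l \in V.
  by have := gsub l (mem_last u g); rewrite inE => /orP[/set1P->//|/(subsetP YV)].
(* As [l] sees at most [d] vertices of [K], the connected set [K] has an edge from a neighbour [w]
   of [l] to a non-neighbour [w']. Ending at [w], or going on to [w'], gives the two parities. *)
have [||w [w' [wKl w'K ww']]] := cK (K :&: [set y in V | e l y]) (subsetIl _ _).
- by case/existsP: Rg => w /andP[wK lw]; apply/set0Pn; exists w; rewrite !inE wK lw (subsetP YV) // (subsetP KY).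
- apply: contraTneq Kd => <-; rewrite -leqNgt; apply: leq_trans (dV l lV).
  by apply/subset_leq_card/subsetIr.
move: wKl w'K; rewrite !inE => /and3P[wK wV lw] /andP[lw' w'K].
have {}lw' : ~~ e l w' by move: lw'; rewrite w'K (subsetP YV) // (subsetP KY).
have gw : induced_path e (u :: rcons g w).
  apply: induced_path_rcons => //; first by apply: contraL wK => /gK.
  move=> z zg; rewrite -/l; have [->|zl] := eqVneq z l; first exact: lw.
  by apply: contraNF zl => zw; rewrite (gR z zg (RP _ _ wK zw)).
have gwY : {subset rcons g w <= Y}.
  by move=> z; rewrite mem_rcons inE => /orP[/eqP->|/gY//]; apply: (subsetP KY).
have [gb|gb] := eqVneq (odd (size g)) b; first by exists g, w.
exists (rcons g w), w'; split=> //; last first.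
- by rewrite size_rcons /=; case: (odd _) b gb => [] [].
- by move=> z; rewrite mem_rcons inE => /orP[/eqP->|/gwY//]; apply: (subsetP KY).
have ww'n : w' != w by apply: contraTneq ww' => ->; rewrite e_irr.
apply: induced_path_rcons => //.
  rewrite -rcons_cons mem_rcons inE negb_or ww'n /=.
  by apply: contraL w'K => /gK.
move=> z; rewrite last_rcons -rcons_cons mem_rcons inE.
have [->|zw] := eqVneq z w; first by rewrite ww'.
move=> /= zg; apply/negbTE; apply: contra lw' => zw'.
by rewrite -(gR z zg (RP _ _ w'K zw')).
Qed.

(** The final fan has centre [c]. Its path starts at a neighbour of [c], runs through [X] to [a],
    follows [E] to [u] and ends at a neighbour [w] of [c] in [K]. *)
Lemma sparse_yields_cycle k V d : 3 <= k -> 0 < d -> no_large_anticomplete e V d ->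
  max_degree e V d -> 40 * (k + 2) * d <= #|V| -> yields_cycle k e V.
Proof.
move=> k3 d0 nV dV Vsize; set M := 8 * k + 10.
have [|X [a [Y [[XV aV YV XY] [[cX cY Ysize dXY aXY] [[x0 x0X x0a] ay Ypar]]]]]] :=
  second_neighbourhood e_sym d0 nV dV; first by clear - Vsize; nia.
have [aX aY] : a \notin X /\ a \notin Y by move: aXY; rewrite inE negb_or => /andP[].
have [|E [Y' [[EP Esize EY Y'Y] [cY' Y'size aEY' uY' Elast]]]] :=
  gyarfas_path (M := M) e_sym d0 YV aV aY cY ay nV dV.
  by rewrite /M; clear - Vsize Ysize; nia.
set u := last a E in uY' Elast.
have Y'large : 6 * d <= #|Y'| by rewrite /M in Y'size; clear - Vsize Ysize Y'size; nia.
(* [B b w] records a neighbour [c] of [w] and the part [s] in [X] of an induced path from [c] to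
   [a], with [b] the parity of the size of [s]. *)
pose B b w := exists c s,
  [/\ c \in V, c \notin X :|: Y, c != a & e c w] /\
  [/\ induced_path e s, {subset s <= X}, forall y, y \in s -> e y a = (y == last a s),
      e c (head a s) & odd (size s) = b].
have BP w : w \in Y' -> exists b, B b w.
  move=> wY'; have [c [cV cXY cw [x xX xc]]] := Ypar w (subsetP Y'Y w wY').
  have cX' := connected_setU1 e_sym cX xX xc.
  have [|s [sP ssub Rs sR]] := induced_path_to e_sym (R := fun y => e y a) cX' (setU11 c X).
    by exists x0; rewrite ?inE ?x0X ?orbT.
  have cs : c \notin s by case/and3P: sP.
  exists (odd (size s)), c, s; split; split=> //.
  (* Of the path [a :: E] only the last vertex sees [Y'], and it is not [a] because [E] is
     nonempty. *)
  - apply: contraTneq cw => ->; apply/negP => aw.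
    have := Elast a w (mem_head _ _) wY' aw; rewrite /u => aE.
    case/negP: aY; apply: EY; rewrite aE; move: Esize; rewrite /M.
    case: (E) => [|z E'] /=; first by clear; lia.
    by move=> _; exact: mem_last.
  - by case/and3P: sP.
  - move=> y ys; have := ssub y; rewrite !inE ys orbT => /(_ isT) /orP[/eqP yc|//].
    by rewrite -yc ys in cs.
  - move=> y ys; have s0 : last c s = last a s by case: (s) ys.
    have ycs : y \in c :: s by rewrite inE ys orbT.
    apply/idP/eqP => [ya|->]; first by rewrite -s0; apply: sR.
    by rewrite -s0.
  - move: sP Rs; case: (s) => [|z t] //=.
    by case/and3P => _ /andP[].
pose W b := [set w in Y' | `[< B b w >]].
have [b Wb] : exists b, 3 * d <= #|W b|.
  have : Y' \subset W true :|: W false.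
    apply/subsetP => w wY'; have [b Bw] := BP w wY'.
    rewrite !inE wY' /=; case: b Bw => Bw; apply/orP; [left|right]; exact/asboolP.
  move/subset_leq_card => h1; have h2 := (leq_card_setU (W true) (W false)).1.
  have [h|h] := leqP (3 * d) #|W true|; first by exists true.
  by exists false; clear - Y'large h h1 h2; lia.
have WY' : W b \subset Y' by apply/subsetP => w; rewrite inE => /andP[].
have Y'V : Y' \subset V := subset_trans Y'Y YV.
have [|K [KW Ksize cK _]] := giant_component e_sym d0 (no_large_anticompleteS (subset_trans WY' Y'V) nV).
  exact: Wb.
have uaE : u \in a :: E by apply: mem_last.
have uV : u \in V by move: uaE; rewrite inE => /orP[/eqP->//|/EY/(subsetP YV)].
have uNY' : u \notin Y' by have := aEY' u uaE; rewrite inE.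
(* The whole path has [size s + M + size g + 2] vertices; this parity of [g] makes that number
   differ from [k] modulo 2. *)
have [||g [w [gP gY' wK godd]]] := paths_of_both_parities (~~ (b (+) odd k (+) odd M)) dV uV uNY' Y'V cY' uY' (subset_trans KW WY') cK.
- by clear - Wb Ksize d0; lia.
- exact: d0.
have := subsetP KW w wK; rewrite inE => /andP[_ /asboolP[c [s [[cV cXY ca cw] [sP sX sa ch sodd]]]]].
set G := rcons g w in gP gY'.
have G0 : G = head a G :: behead G by rewrite /G; case: (g).
have aEG : induced_path e ((a :: E) ++ G).
  apply: (@induced_path_cat _ _ _ _ a EP); first by case/and3P: gP.
  move=> x y xE yG; split.
    by apply: contraTneq (gY' y yG) => <-; have := aEY' x xE; rewrite inE.
  have [->|xu] := eqVneq x u; last first.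
    by apply: contraNF xu => xy; rewrite (Elast x y xE (gY' y yG) xy).
  rewrite /= -?/u ?eqxx /=; move: gP yG; rewrite G0.
  move=> /= /and3P[_ /andP[uh /allP ut] _]; rewrite inE.
  by have [->|_ /ut/negbTE] := eqVneq y (head a G).
have EGY x : x \in E ++ G -> x \in Y.
  by rewrite mem_cat => /orP[/EY //|/gY' /(subsetP Y'Y)].
apply: (@long_fan_path_cycle _ _ e_sym e_irr k V c (s ++ (a :: E) ++ G) k3).
- apply: (@induced_path_cat _ _ _ _ a sP aEG) => x y xs; rewrite /= inE.
  move=> /orP[/eqP->|/EGY yY]; split.
  + by apply: contraNneq aX => <-; apply: sX.
  + by rewrite eqxx andbT sa.
  + apply: contraTneq yY => <-; move: dXY; rewrite disjoints_subset => /subsetP /(_ x (sX x xs)).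
    by rewrite inE.
  + rewrite (negbTE (anticompleteP _ _ _ XY x y (sX x xs) yY)).
    by apply/esym/negbTE; rewrite negb_and; apply/orP; right; apply: contraNneq aY => <-.
- move=> x; rewrite inE mem_cat /= inE => /orP[/eqP->//|/orP[/sX|/orP[/eqP->//|/EGY]]].
    exact: (subsetP XV).
  exact: (subsetP YV).
- rewrite mem_cat /= inE (negbTE ca) /=; apply/negP => /orP[/sX cX'|/EGY cY0].
    by move: cXY; rewrite inE cX'.
  by move: cXY; rewrite inE cY0 orbT.
- by move: ch; case: (s).
- by rewrite !last_cat /G last_rcons.
- clearbody M; rewrite !size_cat /= Esize /G size_rcons !oddD /= sodd godd.
  by clear; case: b (odd k) (odd M) => [] [] [].
- by rewrite !size_cat /= Esize /M; clear; lia.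
Qed.

Lemma long_induced_path V d : 0 < d -> no_large_anticomplete e V d ->
  max_degree e V d -> forall M, (4 * M + 40) * d <= #|V| ->
  exists s, [/\ induced_path e s, size s = M.+1 & {subset s <= V}].
Proof.
move=> d0 nV dV M Vsize.
have [|X [a [Y [[XV aV YV XY] [[cX cY Ysize dXY aXY] [_ ay _]]]]]] :=
  second_neighbourhood e_sym d0 nV dV; first by clear - Vsize; nia.
have aY : a \notin Y by move: aXY; rewrite inE negb_or => /andP[].
have [|E [Y' [[EP Esize EY _] _]]] :=
  gyarfas_path (M := M) e_sym d0 YV aV aY cY ay nV dV.
  by clear - Vsize Ysize; nia.
exists (a :: E); split=> //=; first by rewrite Esize.
by move=> x; rewrite inE => /orP[/eqP->//|/EY/(subsetP YV)].
Qed.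

End SparseCase.

Lemma dense_yields_cycle (T : finType) (e : rel T) k (V : {set T}) d :
  symmetric e -> irreflexive e -> 3 <= k -> 0 < d ->
  no_large_anticomplete (compl_rel e) V d -> max_degree (compl_rel e) V d ->
  40 * (k + 2) * d <= #|V| -> yields_cycle k e V.
Proof.
move=> se ie k3 d0 nV dV Vsize.
have sc := compl_rel_sym se.
have [|s [sP ssize sV]] := long_induced_path sc d0 nV dV (M := 4 * k + 2).
  by clear - Vsize k3; nia.
have [x xs] : exists x, x \in s by case: s ssize {sP sV} => // x s _; exists x; rewrite mem_head.
apply: (@long_antipath_cycle k T e V (nth x s) (4 * k + 3)) => //.
  by clear; lia.
split=> // [i iN|i j ij jN]; first by apply: sV; apply: mem_nth; rewrite ssize; move: iN; clear; lia.
have [|neq] := induced_path_nth x sP ij; first by rewrite ssize; move: jN; clear; lia.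
rewrite /compl_rel neq /= => <-; split=> //; rewrite addbT negbK.
by [].
Qed.

(** * Sparse or dense linear-size subgraphs *)

Section Density.
Variable T : finType.
Implicit Types (f : rel T) (A B V W : {set T}).

Definition edges f A B : nat := \sum_(x in A) \sum_(y in B) f x y.

Definition sparse_to f L A B : Prop :=
  forall x, x \in A -> L * #|[set y in B | f x y]| <= #|B|.

(** Sparseness is asked only from earlier sets to later ones; counting edges recovers a two-sided
    bound on the union. *)
Definition sparse_family f L s V n (U : nat -> {set T}) : Prop :=
  (forall a, a < n -> U a \subset V /\ #|U a| = s) /\
  (forall a b, a < b -> b < n ->
     [disjoint U a & U b] /\ sparse_to f L (U a) (U b)).

Lemma degE f B x : #|[set y in B | f x y]| = \sum_(y in B) f x y.
Proof.
rewrite -sum1_card big_mkcond [RHS]big_mkcond; apply: eq_bigr => y _.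
by rewrite inE; case: (y \in B); case: (f x y).
Qed.

Lemma edgesC f A B : symmetric f -> edges f A B = edges f B A.
Proof.
move=> fs; rewrite /edges exchange_big; apply: eq_bigr => y _.
by apply: eq_bigr => x _; rewrite fs.
Qed.

Lemma edges_sparse f L A B : sparse_to f L A B -> L * edges f A B <= #|A| * #|B|.
Proof.
move=> AB; rewrite /edges big_distrr /= -sum_nat_const.
by apply: leq_sum => x /AB; rewrite degE.
Qed.

Lemma edges_markov f L s A B t : L * edges f A B <= t ->
  #|[set x in A | s < L * #|[set y in B | f x y]|]| * s <= t.
Proof.
apply: leq_trans; rewrite -sum_nat_const /edges big_distrr /=.
rewrite big_mkcond [leqRHS]big_mkcond; apply: leq_sum => x _.
rewrite inE -degE; case: (x \in A) => //=.
by case: ltnP => // /ltnW.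
Qed.

Lemma subset_of_card A n : n <= #|A| -> exists2 B : {set T}, B \subset A & #|B| = n.
Proof.
move=> nA; exists [set x in take n (enum A)].
  by apply/subsetP => x; rewrite inE => /mem_take; rewrite mem_enum.
by rewrite cardsE (card_uniqP (take_uniq _ (enum_uniq _))) size_takel // -cardE.
Qed.

Lemma disjoint_subsets V m k : k * m <= #|V| -> exists U : nat -> {set T},
  (forall i, i < k -> U i \subset V /\ #|U i| = m) /\
  (forall i j, i < j -> j < k -> [disjoint U i & U j]).
Proof.
elim: k V => [|k IH] V kV; first by exists (fun=> set0); split.
have [|B BV Bm] := @subset_of_card V m; first by apply: leq_trans kV; rewrite mulSn leq_addr.
have [|U [Usub Udis]] := IH (V :\: B).
  by have := cardsID B V; rewrite (setIidPr BV) Bm; move: kV; rewrite mulSn; clear; lia.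
exists (fun i => if i is i'.+1 then U i' else B); split.
  move=> [|i] ik //; have [UV Um] := Usub i ik; split=> //.
  by apply: subset_trans UV (subsetDl _ _).
move=> [|i] [|j] // ij jk; last exact: Udis.
have [+ _] := Usub j jk; rewrite subsetD => /andP[_].
by rewrite disjoint_sym.
Qed.

(* Greedy embedding: if no vertex of [V 0] leaves candidate sets that shrink
   by a factor at most [L], then one of the other [V j] is sparse or dense
   to a large part of [V 0]. *)
Lemma embed_or_sparse_pair (e : rel T) (x0 : T) L r (H : nat -> nat -> bool)
    (V : nat -> {set T}) c m : 0 < L -> 0 < m ->
  (forall i, i < r -> m <= c * #|V i|) ->
  (forall i j, i < j -> j < r -> [disjoint V i & V j]) ->
  (exists v : nat -> T, (forall i, i < r -> v i \in V i) /\
     forall i j, i < j -> j < r -> e (v i) (v j) = H i j) \/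
  (exists i j A B, [/\ i < j, j < r, A \subset V i & B \subset V j] /\
     [/\ m <= c * r * L ^ r * #|A|, m <= c * r * L ^ r * #|B| &
       sparse_to e L A B \/ sparse_to (compl_rel e) L A B]).
Proof.
move=> L0 m0; elim: r H V c => [|r IH] H V c Vm Vdis.
  by left; exists (fun=> x0); split.
pose C x j := [set y in V j.+1 | e x y == H 0 j.+1].
have [/existsP[x /andP[xV /forallP xC]]|nox] :=
    boolP [exists x in V 0, [forall j : 'I_r, #|V j.+1| <= L * #|C x j|]].
  have CV j : C x j \subset V j.+1 by apply/subsetP => y; rewrite inE => /andP[].
  have [||[v [vC vH]]|] := IH (fun i j => H i.+1 j.+1) (C x) (c * L).
  - move=> i ir; apply: leq_trans (Vm i.+1 ir) _; rewrite -mulnA leq_mul2l.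
    by rewrite (xC (Ordinal ir)) orbT.
  - move=> i j ij jr; apply: disjointWl (CV i) _; apply: disjointWr (CV j) _.
    exact: Vdis.
  - left; exists (fun i => if i is i'.+1 then v i' else x); split.
      by move=> [|i] //= ir; apply: (subsetP (CV i)); apply: vC.
    move=> [|i] [|j] //= ij jr; last exact: vH.
    by have := vC j jr; rewrite inE => /andP[_ /eqP].
  - move=> [i [j [A [B [[ij jr AV BV] [mA mB AB]]]]]]; right.
    have bound n : m <= c * L * r * L ^ r * n -> m <= c * r.+1 * L ^ r.+1 * n.
      move=> /leq_trans; apply; rewrite leq_mul2r; apply/orP; right.
      by rewrite expnS; clear; nia.
    exists i.+1, j.+1, A, B; split; split=> //; try exact: bound.
    + exact: subset_trans AV (CV i).
    + exact: subset_trans BV (CV j).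
pose A (j : 'I_r) := [set x in V 0 | L * #|C x j| < #|V j.+1|].
have V0 : 0 < #|V 0|.
  by have := Vm 0 isT; rewrite lt0n; apply: contraTneq => ->; rewrite muln0 -ltnNge.
(* Every vertex of [V 0] fails at some index, so one index accounts for at least a fraction 1/r of
   them. *)
have [j Aj] : exists j, #|V 0| <= r * #|A j|.
  apply/existsP; apply: contraTT isT => /existsPn small.
  have cover : #|V 0| <= \sum_(j < r) #|A j|.
    apply: leq_trans (_ : #|\bigcup_(j < r) A j| <= _).
      apply/subset_leq_card/subsetP => x xV; move/existsPn: nox => /(_ x).
      rewrite xV /= => /forallPn[j]; rewrite -ltnNge => xj.
      by apply/bigcupP; exists j => //; rewrite inE xV.
    elim/big_rec2: _ => [|j n B _ IHn]; first by rewrite cards0.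
    by apply: leq_trans (leq_card_setU _ _).1 _; rewrite leq_add2l.
  have : \sum_(j < r) (r * #|A j|) <= \sum_(j < r) #|V 0|.-1.
    by apply: leq_sum => j _; have := small j; rewrite -ltnNge; move: V0; clear; lia.
  rewrite -big_distrr /= sum_nat_const card_ord leq_mul2l => /orP[/eqP r0|].
    move: cover; rewrite r0 in A small *; rewrite big_ord0; move: V0; clear; lia.
  by move=> /(leq_trans cover); rewrite -ltnS prednK // ltnn.
right; exists 0, j.+1, (A j), (V j.+1).
have Lpow n : 0 < L ^ n by rewrite expn_gt0 L0.
have r0 : 0 < r := leq_ltn_trans (leq0n j) (ltn_ord j).
split; split=> //.
- exact: ltn_ord.
- by apply/subsetP => x; rewrite inE => /andP[].
- apply: leq_trans (Vm 0 isT) _; apply: leq_trans (_ : c * (r * #|A j|) <= _).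
    by rewrite leq_mul2l Aj orbT.
  by have := Lpow r.+1; move: (L ^ _) => n; clear; nia.
- apply: leq_trans (Vm j.+1 (ltn_ord j)) _; have := Lpow r.+1.
  by move: (L ^ _) => n; clear; nia.
- have AC x : x \in A j -> L * #|C x j| <= #|V j.+1|.
    by rewrite inE => /andP[_ /ltnW].
  (* The small set [C x j] consists of neighbours of [x] if the pattern asks for an edge, and of
     non-neighbours otherwise. *)
  have [Hj|Hj] := boolP (H 0 j.+1); [left|right] => x /AC; apply: leq_trans.
    rewrite leq_mul2l; apply/orP; right; apply/subset_leq_card/subsetP => y.
    by rewrite !inE Hj eqb_id.
  rewrite leq_mul2l; apply/orP; right; apply/subset_leq_card/subsetP => y.
  by rewrite !inE /compl_rel (negbTE Hj) eqbF_neg => /and3P[-> _ ->].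
Qed.

(** Shrinking [A] is harmless, but a small subset of [B] might catch all the edges. So [A] is cut to
    [2 * s] vertices, Markov's inequality discards at most half of [B], and after choosing [s]
    vertices there it discards at most [s] vertices on the side of [A]. *)
Lemma balance_sparse_pair f L s A B : symmetric f -> 0 < s ->
  2 * s <= #|A| -> 2 * s <= #|B| -> sparse_to f (4 * L) A B ->
  exists A' B', [/\ A' \subset A, B' \subset B, #|A'| = s, #|B'| = s & sparse_to f L A' B'].
Proof.
move=> fs s0 sA sB AB; have [A1 A1A A1s] := subset_of_card sA.
have AB1 : sparse_to f (4 * L) A1 B by move=> x /(subsetP A1A)/AB.
pose bad := [set y in B | s < L * #|[set x in A1 | f y x]|].
have badS : bad \subset B by apply/subsetP => y; rewrite inE => /andP[].
have badB : 2 * #|bad| <= #|B|.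
  have := edges_sparse AB1; rewrite (edgesC _ _ fs) A1s => h.
  have := @edges_markov f (2 * L) (2 * s) B A1 (s * #|B|) ltac:(move: h; clear; nia).
  rewrite (_ : [set x in B | _] = bad); last first.
    by apply/setP => y; rewrite !inE -mulnA ltn_pmul2l.
  by move=> h2; rewrite -(leq_pmul2l s0); move: h2; clear; nia.
have [|B2 B2B B2s] := @subset_of_card (B :\: bad) s.
  by have := cardsID bad B; rewrite (setIidPr badS); move: badB sB; clear; lia.
have B2A1 : L * edges f B2 A1 <= s * s.
  rewrite /edges big_distrr /= -{1}B2s -sum_nat_const; apply: leq_sum => y.
  by move=> /(subsetP B2B); rewrite !inE -degE => /andP[+ yB]; rewrite yB -leqNgt.
pose bad' := [set x in A1 | s < L * #|[set y in B2 | f x y]|].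
have bad's : #|bad'| <= s.
  have := @edges_markov f L s A1 B2 (s * s); rewrite (edgesC _ _ fs) => /(_ B2A1).
  by rewrite leq_pmul2r.
have bad'S : bad' \subset A1 by apply/subsetP => y; rewrite inE => /andP[].
have [|A2 A2A A2s] := @subset_of_card (A1 :\: bad') s.
  by have := cardsID bad' A1; rewrite (setIidPr bad'S); move: bad's A1s; clear; lia.
exists A2, B2; split=> //.
- exact: subset_trans A2A (subset_trans (subsetDl _ _) A1A).
- exact: subset_trans B2B (subsetDl _ _).
- move=> x /(subsetP A2A); rewrite !inE => /andP[+ xA1].
  by rewrite xA1 -leqNgt B2s.
Qed.

End Density.

(** * Families of pairwise sparse sets *)

Lemma sparse_pair_exists (k L : nat) : 0 < L -> exists2 D, 0 < D &
  forall (T : finType) (e : rel T) (V : {set T}) s, symmetric e -> irreflexive e ->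
    0 < s -> D * s <= #|V| ->
    yields_cycle k e V \/
    exists A B : {set T}, [/\ A \subset V, B \subset V & [disjoint A & B]] /\
      [/\ #|A| = s, #|B| = s & sparse_to e L A B \/ sparse_to (compl_rel e) L A B].
Proof.
move=> L0; have [K K0 KE] : exists2 K, 0 < K & K = k.+1 * (4 * L) ^ k.
  by exists (k.+1 * (4 * L) ^ k); rewrite // muln_gt0 expn_gt0 muln_gt0 L0.
exists (k.+1 * (2 * K)); first by rewrite !muln_gt0 K0.
move=> T e V s es ei s0 Vs.
have [x0 _] : exists x, x \in V.
  by apply/set0Pn; rewrite -card_gt0; apply: leq_trans Vs; rewrite !muln_gt0 K0 s0.
have [|U [Usub Udis]] := @disjoint_subsets T V (2 * K * s) k.
  by apply: leq_trans Vs; rewrite -[leqRHS]mulnA leq_mul2r leqnSn orbT.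
have L4 : 0 < 4 * L by rewrite muln_gt0.
have m0 : 0 < 2 * K * s by rewrite !muln_gt0 K0.
have [|[v [vU vE]]|] := @embed_or_sparse_pair T e x0 (4 * L) k
    (fun i j => (i.+1 %% k == j) || (j.+1 %% k == i)) U 1 _ L4 m0 _ Udis.
- by move=> i /Usub[_ ->]; rewrite mul1n.
- left; apply: (@yields_cycle_induced _ _ _ _ v) => // [i ik|i j ij jk].
    by apply: (subsetP (Usub i ik).1); apply: vU.
  apply: contraTneq (vU i (ltn_trans ij jk)) => ->.
  by rewrite (disjointFl (Udis i j ij jk)) // vU.
move=> [i [j [A [B [[ij jk AU BU] [mA mB AB]]]]]]; right.
have large n : 2 * K * s <= 1 * k * (4 * L) ^ k * n -> 2 * s <= n.
  move=> h; rewrite -(leq_pmul2l K0); rewrite mulnCA mulnA; apply: leq_trans h _.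
  by rewrite KE mul1n leq_mul2r leq_mul2r leqnSn !orbT.
have AV : A \subset V := subset_trans AU (Usub i (ltn_trans ij jk)).1.
have BV : B \subset V := subset_trans BU (Usub j jk).1.
have dAB : [disjoint A & B].
  by apply: disjointWl AU _; apply: disjointWr BU _; apply: Udis.
have [f [fs fE AB']] : exists f : rel T, [/\ symmetric f,
    forall A B, sparse_to f L A B -> sparse_to e L A B \/ sparse_to (compl_rel e) L A B
    & sparse_to f (4 * L) A B].
  case: AB => AB; first by exists e; split=> // A' B' ?; left.
  by exists (compl_rel e); split=> //; [exact: compl_rel_sym | move=> A' B' ?; right].
have [A' [B' [AA BB As Bs AB2]]] := balance_sparse_pair fs s0 (large _ mA) (large _ mB) AB'.
exists A', B'; split; split=> //; last exact: fE.
- exact: subset_trans AA AV.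
- exact: subset_trans BB BV.
- by apply: disjointWl AA _; apply: disjointWr BB _.
Qed.

Section Families.
Variable T : finType.
Implicit Types (f : rel T) (A B V W : {set T}).

Lemma sparse_familyS f L s V W n U : V \subset W ->
  sparse_family f L s V n U -> sparse_family f L s W n U.
Proof.
by move=> VW [Us Ud]; split=> // a /Us[UV Ua]; split=> //; apply: subset_trans VW.
Qed.

Lemma sparse_family1 f L s V : s <= #|V| -> exists U, sparse_family f L s V 1 U.
Proof.
move=> /subset_of_card[B BV Bs]; exists (fun=> B); split=> //.
by move=> a [|b]; rewrite ?ltn0 // ltnS ltn0.
Qed.

(** Restricting [B] to a set smaller by the factor [D] weakens sparseness from [L * D] to [L]. *)
Lemma sparse_family_double f L D s V A B n U1 U2 :
  A \subset V -> B \subset V -> [disjoint A & B] -> 0 < D -> #|B| = D * s ->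
  sparse_to f (L * D) A B ->
  sparse_family f L s A n U1 -> sparse_family f L s B n U2 ->
  exists U, sparse_family f L s V (n + n) U.
Proof.
move=> AV BV dAB D0 Bs AB [U1s U1d] [U2s U2d].
exists (fun a => if a < n then U1 a else U2 (a - n)); split=> [a an|a b ab bn].
  have [a1|a1] := ltnP a n.
    by have [UA Ua] := U1s a a1; split=> //; apply: subset_trans AV.
  have [|UB Ua] := U2s (a - n); first by move: a1 an; clear; lia.
  by split=> //; apply: subset_trans BV.
have [b1|b1] := ltnP b n; first by rewrite (ltn_trans ab b1); apply: U1d.
have [|UB Ub] := U2s (b - n); first by move: b1 bn; clear; lia.
have [a1|a1] := ltnP a n; last by apply: U2d; move: ab b1 a1 bn; clear; lia.
have [UA Ua] := U1s a a1; split; first by apply: disjointWl UA _; apply: disjointWr UB _.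
move=> x /(subsetP UA)/AB; rewrite Ub Bs [L * D]mulnC -mulnA leq_pmul2l //.
apply: leq_trans; rewrite leq_mul2l; apply/orP; right.
apply/subset_leq_card/subsetP => y; rewrite !inE => /andP[yU ->].
by rewrite (subsetP UB).
Qed.

(** The average degree in the union is at most [2 * s]: at most [s] from inside a set and [s] on
    average from the other sets. Hence at most half of the vertices have degree above [4 * s], and
    these are removed. *)
Lemma sparse_family_union f s V r U : symmetric f -> irreflexive f -> 0 < s ->
  sparse_family f r s V r U ->
  exists W, [/\ W \subset V, r * s <= 2 * #|W| & max_degree f W (4 * s)].
Proof.
move=> fs fi s0 [Us Ud].
pose X := \bigcup_(a < r) U a.
have dis (a b : 'I_r) : a != b -> [disjoint U a & U b].
  rewrite -(inj_eq val_inj) neq_ltn => /orP[ab|ba]; first by case: (Ud a b).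
  by rewrite disjoint_sym; case: (Ud b a).
have sumX F : \sum_(x in X) F x = \sum_(a < r) \sum_(x in U a) F x :> nat.
  by apply: partition_disjoint_bigcup.
have Xcard : #|X| = r * s.
  rewrite -sum1_card sumX (eq_bigr (fun=> s)) ?sum_nat_const ?card_ord // => a _.
  by rewrite sum1_card (Us a (ltn_ord a)).2.
have XV : X \subset V by apply/bigcupsP => a _; exact: (Us a (ltn_ord a)).1.
have pair (a b : 'I_r) : r * edges f (U a) (U b) <= s * s + (a == b) * (r * (s * s)).
  have [ab|ab|/val_inj ->] := ltngtP a b.
  - apply: leq_trans (leq_addr _ _); have [_ ab'] := Ud a b ab (ltn_ord b).
    by have := edges_sparse ab'; rewrite (Us a (ltn_ord a)).2 (Us b (ltn_ord b)).2.
  - apply: leq_trans (leq_addr _ _); have [_ ab'] := Ud b a ab (ltn_ord a).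
    by have := edges_sparse ab'; rewrite edgesC // (Us a (ltn_ord a)).2 (Us b (ltn_ord b)).2.
  - rewrite eqxx mul1n; apply: leq_trans (leq_addl _ _); rewrite leq_mul2l; apply/orP; right.
    rewrite -{1}(Us b (ltn_ord b)).2 -sum_nat_const; apply: leq_sum => x _.
    by rewrite -degE -(Us b (ltn_ord b)).2; apply/subset_leq_card/subsetP => y; rewrite inE => /andP[].
have XX : r * edges f X X <= r * (2 * r * s * s).
  have -> : edges f X X = \sum_(a < r) \sum_(b < r) edges f (U a) (U b).
    rewrite /edges sumX; apply: eq_bigr => a _; rewrite [RHS]exchange_big /=.
    by apply: eq_bigr => x _; rewrite sumX.
  rewrite big_distrr /=.
  apply: leq_trans (_ : \sum_(a < r) (2 * r * s * s) <= _); last first.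
    by rewrite sum_nat_const card_ord.
  apply: leq_sum => a _; rewrite big_distrr /=.
  apply: leq_trans (_ : \sum_(b < r) (s * s + (a == b) * (r * (s * s))) <= _).
    by apply: leq_sum => b _; apply: pair.
  rewrite big_split /= sum_nat_const card_ord -big_distrl /=.
  rewrite (bigD1 a) //= eqxx big1 ?addn0; last by move=> b; rewrite eq_sym => /negbTE->.
  by clear; nia.
have [r0|r0] := posnP r.
  by exists set0; split; rewrite ?sub0set ?r0 // => v; rewrite inE.
pose bad := [set x in X | 4 * s < 1 * #|[set y in X | f x y]|].
have badX : bad \subset X by apply/subsetP => x; rewrite inE => /andP[].
have bads : 2 * #|bad| <= r * s.
  have := @edges_markov T f 1 (4 * s) X X (2 * r * s * s).
  rewrite mul1n -(leq_pmul2l r0) => /(_ XX) h.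
  by rewrite -(leq_pmul2l s0); move: h; rewrite -/bad; clear; nia.
exists (X :\: bad); split.
- exact: subset_trans (subsetDl _ _) XV.
- by have := cardsID bad X; rewrite (setIidPr badX) Xcard; move: bads; clear; lia.
- move=> x; rewrite !inE => /andP[+ xX]; rewrite xX -leqNgt mul1n; apply: leq_trans.
  by apply/subset_leq_card/subsetP => y; rewrite !inE => /andP[/andP[_ ->] ->].
Qed.

End Families.

(** A Ramsey-type induction on [i + j]. A sparse pair allows recursion on both sides with [i]
    lowered, and two sparse families found there combine into one of twice the length; a dense pair
    does the same for [j]. *)
Lemma sparse_family_exists (k L i j : nat) : 0 < L -> exists2 D, 0 < D &
  forall (T : finType) (e : rel T) (V : {set T}) s, symmetric e -> irreflexive e ->
    0 < s -> D * s <= #|V| ->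
    [\/ yields_cycle k e V, exists U, sparse_family e L s V (2 ^ i) U |
      exists U, sparse_family (compl_rel e) L s V (2 ^ j) U].
Proof.
move=> L0; have [n] := ubnP (i + j); elim: n => // n IH in i j *.
case: i => [|i] ijn.
  exists 1 => // T e V s _ _ _; rewrite mul1n => sV.
  by apply: Or32; apply: sparse_family1.
case: j => [|j] in ijn *.
  exists 1 => // T e V s _ _ _; rewrite mul1n => sV.
  by apply: Or33; apply: sparse_family1.
have [|D1 D10 HD1] := IH i j.+1; first by move: ijn; clear; lia.
have [|D2 D20 HD2] := IH i.+1 j; first by move: ijn; clear; lia.
(* Pairs of size [D * s] leave room for either recursive call. *)
pose D := D1 + D2; have D0 : 0 < D by rewrite addn_gt0 D10.
have [|D' D'0 HD'] := @sparse_pair_exists k (L * D); first by rewrite muln_gt0 L0.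
exists (D' * D); first by rewrite muln_gt0 D'0.
move=> T e V s es ei s0 Vs.
have [||yV|[A [B [[AV BV dAB] [As Bs [AB|AB]]]]]] := HD' T e V (D * s) es ei.
- by rewrite muln_gt0 D0.
- by rewrite mulnA.
- exact: Or31.
- have le1 : D1 * s <= D * s by rewrite leq_mul2r leq_addr orbT.
  have [|yA|[U1 U1P]|[U UP]] := HD1 T e A s es ei s0; first by rewrite As.
  + by apply: Or31; apply: yields_cycleS yA.
  + have [|yB|[U2 U2P]|[U UP]] := HD1 T e B s es ei s0; first by rewrite Bs.
    * by apply: Or31; apply: yields_cycleS yB.
    * apply: Or32; rewrite expnS mul2n -addnn.
      exact: sparse_family_double AV BV dAB D0 Bs AB U1P U2P.
    * by apply: Or33; exists U; apply: sparse_familyS UP.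
  + by apply: Or33; exists U; apply: sparse_familyS UP.
- have le2 : D2 * s <= D * s by rewrite leq_mul2r leq_addl orbT.
  have [|yA|[U UP]|[U1 U1P]] := HD2 T e A s es ei s0; first by rewrite As.
  + by apply: Or31; apply: yields_cycleS yA.
  + by apply: Or32; exists U; apply: sparse_familyS UP.
  + have [|yB|[U UP]|[U2 U2P]] := HD2 T e B s es ei s0; first by rewrite Bs.
    * by apply: Or31; apply: yields_cycleS yB.
    * by apply: Or32; exists U; apply: sparse_familyS UP.
    * apply: Or33; rewrite expnS mul2n -addnn.
      exact: sparse_family_double AV BV dAB D0 Bs AB U1P U2P.
Qed.

(** * Pure pairs and the Erdos-Hajnal property *)

Lemma pure_pair_of_sparse_set (k : nat) (T : finType) (e f : rel T) (V W : {set T}) d :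
  W \subset V ->
  (no_large_anticomplete f W d -> yields_cycle k e W) ->
  yields_cycle k e V \/ exists A B : {set T},
    [/\ A \subset V, B \subset V & [disjoint A & B]] /\
    [/\ d <= #|A|, d <= #|B| & anticomplete f A B].
Proof.
move=> WV yW; have [nW|large] := pselect (no_large_anticomplete f W d).
  by left; apply: yields_cycleS WV (yW nW).
right; apply: contrapT => noAB; apply: large => A B AW BW dAB AB.
have [|dA] := ltnP #|A| d; first by left.
have [|dB] := ltnP #|B| d; first by right.
by case: noAB; exists A, B; split; split=> //; apply: subset_trans WV.
Qed.

Lemma linear_pure_pair (k : nat) : 3 <= k -> exists D,
  forall (T : finType) (e : rel T) (V : {set T}), symmetric e -> irreflexive e ->
    D <= #|V| ->
    yields_cycle k e V \/
    exists A B : {set T}, [/\ A \subset V, B \subset V & [disjoint A & B]] /\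
      [/\ #|V| <= D * #|A|, #|V| <= D * #|B| &
        anticomplete e A B \/ anticomplete (compl_rel e) A B].
Proof.
(* The union of [r] sets of size [s] keeps half its vertices and has degree bound [4 * s]; since
   [r >= i], this half is at least [40 * (k + 2)] times that bound. *)
move=> k3; have [i iE] : exists i, i = 8 * (40 * (k + 2)) by exists (8 * (40 * (k + 2))).
have [r rE ir] : exists2 r, r = 2 ^ i & i <= r.
  by exists (2 ^ i) => //; apply/ltnW/ltn_expl.
have r0 : 0 < r by rewrite rE expn_gt0.
have [D0 D00 HD0] := sparse_family_exists k i i r0; rewrite -rE in HD0.
exists (8 * D0) => T e V es ei VD; pose s := #|V| %/ D0.
have s0 : 0 < s by rewrite divn_gt0 //; apply: leq_trans VD; rewrite leq_pmull.
have sV : D0 * s <= #|V| by rewrite mulnC leq_trunc_div.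
have Vs : #|V| <= D0 * s.+1 by rewrite ltnW // mulnC ltn_ceil.
have large n : 4 * s <= n -> #|V| <= 8 * D0 * n.
  by move: Vs s0; clearbody s; clear; nia.
have Wlarge (W : {set T}) : r * s <= 2 * #|W| -> 40 * (k + 2) * (4 * s) <= #|W|.
  by move: ir; rewrite iE; clear; nia.
have d0 : 0 < 4 * s by rewrite muln_gt0.
have [yV|[U /(sparse_family_union es ei s0)[W [WV Wr Wd]]]|
  [U /(sparse_family_union (compl_rel_sym es) (@compl_rel_irr _ _) s0)[W [WV Wr Wd]]]] :=
  HD0 T e V s es ei s0 sV; first by left.
- have [|yV|[A [B [AB [dA dB an]]]]] := @pure_pair_of_sparse_set k T e e V W (4 * s) WV.
  + by move=> nW; apply: (sparse_yields_cycle es ei k3 d0 nW Wd); apply: Wlarge.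
  + by left.
  + by right; exists A, B; split=> //; split; [exact: large|exact: large|left].
- have [|yV|[A [B [AB [dA dB an]]]]] := @pure_pair_of_sparse_set k T e (compl_rel e) V W (4 * s) WV.
  + by move=> nW; apply: (dense_yields_cycle es ei k3 d0 nW Wd); apply: Wlarge.
  + by left.
  + by right; exists A, B; split=> //; split; [exact: large|exact: large|right].
Qed.

(** * From pure pairs to large independent sets and cliques *)

Lemma independentU (G : sgraph) (A B : {set G}) : independent A -> independent B ->
  anticomplete adj A B -> independent (A :|: B).
Proof.
move=> /forall_inP iA /forall_inP iB /anticompleteP AB.
apply/forall_inP => x; rewrite inE => /orP[xA|xB]; apply/forall_inP => y;
  rewrite inE => /orP[yA|yB].
- exact: (forall_inP (iA x xA)).
- exact: AB.
- by rewrite adj_sym; apply: AB.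
- exact: (forall_inP (iB x xB)).
Qed.

Lemma cliqueU (G : sgraph) (A B : {set G}) : clique A -> clique B ->
  anticomplete (compl_rel adj) A B -> clique (A :|: B).
Proof.
move=> /forall_inP cA /forall_inP cB /anticompleteP AB.
have {}AB x y : x \in A -> y \in B -> x != y -> adj x y.
  by move=> xA yB xy; have := AB x y xA yB; rewrite /compl_rel xy negbK.
apply/forall_inP => x; rewrite inE => /orP[xA|xB]; apply/forall_inP => y;
  rewrite inE => /orP[yA|yB].
- exact: (forall_inP (cA x xA)).
- by apply/implyP; apply: AB.
- by apply/implyP; rewrite eq_sym adj_sym; apply: AB.
- exact: (forall_inP (cB x xB)).
Qed.

(* The product of independence and clique numbers is superadditive on pure pairs. *)
Lemma independent_clique_product (k : nat) : 3 <= k -> exists2 q, 0 < q &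
  forall G : sgraph, ~ has_cycle_minor k G -> forall j (V : {set G}), 2 ^ (q * j) <= #|V| ->
    exists A B : {set G}, [/\ A \subset V, B \subset V, independent A, clique B &
      2 ^ j <= #|A| * #|B|].
Proof.
move=> k3; have [D HD] := linear_pure_pair k3.
(* Each side of a pure pair keeps at least a fraction 1/D of the vertices, so one level of the
   recursion costs a factor of at most [2 ^ D.+1]. *)
have Dq : D <= 2 ^ D.+1 by rewrite ltnW // (ltn_trans _ (ltn_expl D.+1 (ltnSn 1))).
exists D.+1 => // G noC; set q := D.+1 in Dq *; elim=> [|j IH] V.
  rewrite muln0 expn0 => /card_gt0P[x xV]; exists [set x], [set x].
  rewrite !sub1set xV cards1; split=> //; apply/forall_inP => y /set1P ->;
    apply/forall_inP => z /set1P ->; by rewrite ?adj_irr ?eqxx.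
rewrite mulnS expnD => Vlarge.
have [|yV|[A [B [[AV BV dAB] [VA VB AB]]]]] := HD G adj V (@adj_sym G) (@adj_irr G).
- by apply: leq_trans Dq (leq_trans _ Vlarge); rewrite leq_pmulr // expn_gt0.
- by case: noC; apply: has_cycle_minor_yields yV.
have part (X : {set G}) : #|V| <= D * #|X| -> 2 ^ (q * j) <= #|X|.
  move=> VX; rewrite -(@leq_pmul2l (2 ^ q)) ?expn_gt0 //; apply: leq_trans Vlarge _.
  by apply: leq_trans VX _; rewrite leq_mul2r Dq orbT.
have [A1 [B1 [A1A B1A iA1 cB1 p1]]] := IH A (part A VA).
have [A2 [B2 [A2B B2B iA2 cB2 p2]]] := IH B (part B VB).
have anti (f : rel G) (X Y : {set G}) : X \subset A -> Y \subset B -> anticomplete f A B -> anticomplete f X Y.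
  move=> XA YB /anticompleteP h; apply/anticompleteP => x y xX yY.
  by apply: h; [apply: (subsetP XA)|apply: (subsetP YB)].
have card (X Y : {set G}) : X \subset A -> Y \subset B -> #|X :|: Y| = #|X| + #|Y|.
  by move=> XA YB; apply/eqP; rewrite (leq_card_setU X Y).2; apply: disjointWl XA _; apply: disjointWr YB _.
have A1V := subset_trans A1A AV; have A2V := subset_trans A2B BV.
have B1V := subset_trans B1A AV; have B2V := subset_trans B2B BV.
(* Uniting the two sets of one kind and keeping the larger set of the other kind gives a product of
   at least [#|A1| * #|B1| + #|A2| * #|B2|]. *)
rewrite expnS; case: AB => AB.
  have iA := independentU iA1 iA2 (anti _ _ _ A1A A2B AB).
  have [BB|BB] := leqP #|B1| #|B2|.
    exists (A1 :|: A2), B2; rewrite subUset A1V A2V card //; split=> //.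
    by move: p1 p2 BB; clear; nia.
  exists (A1 :|: A2), B1; rewrite subUset A1V A2V card //; split=> //.
  by move: p1 p2 BB; clear; nia.
have cB := cliqueU cB1 cB2 (anti _ _ _ B1A B2B AB).
have [AA|AA] := leqP #|A1| #|A2|.
  exists A2, (B1 :|: B2); rewrite subUset B1V B2V card //; split=> //.
  by move: p1 p2 AA; clear; nia.
exists A1, (B1 :|: B2); rewrite subUset B1V B2V card //; split=> //.
by move: p1 p2 AA; clear; nia.
Qed.

(** With [j] the logarithm of [#|G|] to base [2 ^ q], rounded down, [2 ^ j <= m * m] and
    [#|G| < (2 ^ j.+1) ^ q]. For positive [j], [2 ^ j.+1] is at most [(2 ^ j) ^ 2], hence at most
    [m ^ 4]. *)
Lemma card_le_exp_alpha_omega (k : nat) : 3 <= k -> exists2 q, 0 < q &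
  forall G : sgraph, ~ has_cycle_minor k G ->
    #|G| <= maxn (alpha G) (omega G) ^ (4 * q).
Proof.
move=> k3; have [q q0 Hq] := independent_clique_product k3; exists q => // G noC.
set m := maxn _ _.
have mA (A : {set G}) : independent A -> #|A| <= m.
  by move=> iA; rewrite leq_max; apply/orP; left; apply: leq_bigmax_cond.
have mB (B : {set G}) : clique B -> #|B| <= m.
  by move=> cB; rewrite leq_max; apply/orP; right; apply: leq_bigmax_cond.
clearbody m; have [->//|n0] := posnP #|G|.
have [n1|n2] := leqP #|G| 1.
  have [x _] : exists x, x \in G by apply/card_gt0P.
  apply: leq_trans n1 _; rewrite expn_gt0; apply/orP; left.
  rewrite -(cards1 x); apply: mA; apply/forall_inP => y /set1P ->.
  by apply/forall_inP => z /set1P ->; rewrite adj_irr.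
(* This serves the case [j = 0], where the product bound says nothing. *)
have m2 : 2 <= m.
  have [x [y [_ _ xy]]] := card_gt1P n2.
  have c2 : #|[set x; y]| = 2 by rewrite cards2 xy.
  have [axy|axy] := boolP (adj x y); rewrite -c2.
    apply: mB; apply/forall_inP => z /set2P[]->; apply/forall_inP => w /set2P[]->;
      by rewrite ?eqxx // ?axy ?implybT // adj_sym axy implybT.
  apply: mA; apply/forall_inP => z /set2P[]->; apply/forall_inP => w /set2P[]->;
    by rewrite ?adj_irr // adj_sym.
have q1 : 1 < 2 ^ q by rewrite -{1}(expn0 2) ltn_exp2l.
set j := trunc_log (2 ^ q) #|G|.
have jG := trunc_logP q1 n0; have Gj := trunc_log_ltn #|G| q1.
rewrite -/j -!expnM in jG Gj.
have [|A [B [_ _ iA cB AB]]] := Hq G noC j setT; first by rewrite cardsT.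
have mj : 2 ^ j <= m * m by apply: leq_trans AB _; apply: leq_mul; [exact: mA|exact: mB].
apply: leq_trans (ltnW Gj) _; rewrite mulnC [4 * q]mulnC expnM [q * 4]mulnC expnM.
rewrite leq_exp2r //; case: (j) mj => [_|i mi].
  by apply: (@leq_trans (2 ^ 4)); rewrite ?leq_exp2r.
apply: (@leq_trans ((2 ^ i.+1) ^ 2)); first by rewrite -expnM leq_exp2l //; clear; lia.
by rewrite (_ : m ^ 4 = (m * m) ^ 2) ?leq_exp2r // expnMn -expnD.
Qed.

From mathcomp Require Import all_classical all_reals all_analysis.

Import Order.TTheory GRing.Theory Num.Theory.
Local Open Scope ring_scope.

Theorem theorem1p4 (R : realType) (k : nat) (hk : (3 <= k)%N) :
  exists2 eps : R, 0 < eps &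
    forall G : sgraph,
      ~ (exists2 H : sgraph, pivot_minor H G & isomorphic H (cycle_graph k)) ->
      (#|G|%:R : R) `^ eps <= (maxn (alpha G) (omega G))%:R.
Proof.
have [q q0 Hq] := card_le_exp_alpha_omega hk.
have q4 : (0 < 4 * q)%N by rewrite muln_gt0.
exists ((4 * q)%:R^-1) => [|G noC]; first by rewrite invr_gt0 ltr0n.
set m := maxn _ _.
have Gm : (#|G|%:R : R) <= m%:R ^+ (4 * q) by rewrite -natrX ler_nat; apply: Hq.
have mE : (m%:R : R) = (m%:R ^+ (4 * q)) `^ (4 * q)%:R^-1.
  by rewrite -powR_mulrn ?ler0n // -powRrM mulfV ?powRr1 ?ler0n // pnatr_eq0 -lt0n.
by rewrite [leRHS]mE; apply: ge0_ler_powR; rewrite ?nnegrE ?exprn_ge0 ?ler0n ?invr_ge0 ?ler0n.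
Qed.
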